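(* Let $V$ be the $2|1$-dimensional complex $\mathbb{Z}_2$-graded vector space with basis $v_1,v_2$ (even) and $v_3$ (odd), and for $(p,q)\in\mathbb{C}^2$ let $d_{13}(p:q)=\psi^{22}_3+p\,\psi^{21}_3+q\,\psi^{12}_3$. A miniversal deformation of $d_{13}(0:0)=\psi^{22}_3$ is given by $$\begin{aligned}d^\infty=\;&\psi^{22}_3+t_4\psi^{11}_3+t_3\psi^{21}_3+t_2\psi^{33}_3-t_1\psi^{23}_1+t_1t_3\psi^{31}_1+t_1\psi^{32}_1-t_2t_3\psi^{13}_2\\&+(-t_2+t_1t_3)\psi^{23}_2+(t_1t_4+t_2t_3-2t_3^2t_1)\psi^{31}_2+(t_2-2t_1t_3)\psi^{32}_2,\end{aligned}$$ with base the quotient of $\mathbb{C}[[t_1,t_2,t_3,t_4]]$ by the nine relations $$t_1t_4-t_2t_3=0,\quad t_1(2t_3^2-t_4)=0,\quad t_1t_3=0,\quad (2t_1t_3-t_2)(t_4-t_3^2)=0,\quad t_1(t_4-t_3)=0,$$ $$t_1t_4=0,\quad t_1t_3=0,\quad t_1t_3t_4=0,\quad t_1t_4+t_2t_3-2t_1t_3^2=0.$$ The solutions of these relations are $t_3=t_4=0$ and $t_1=t_2=0$, so the base is given by two planes that intersect transversally at the origin. Moreover: (a) The first solution $t_3=t_4=0$ gives the codifferential $d^\infty=\psi^{22}_3+t_1\psi^{32}_1-t_1\psi^{23}_1+t_2\psi^{32}_2-t_2\psi^{23}_2+t_2\psi^{33}_3$, which is equivalent to $d_1=\psi^{23}_2-\psi^{32}_2+\psi^{22}_3-\psi^{33}_3$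 except on the line $t_2=0$, where it jumps to $d_{12}=\psi^{22}_3+\psi^{23}_1-\psi^{32}_1$. (b) The second solution $t_1=t_2=0$ gives the codifferential $d^\infty=\psi^{22}_3+t_3\psi^{21}_3+t_4\psi^{11}_3$, which gives jump deformations to $d_{13}(p:q)$ for all $(p:q)$ except $(0:0)$.
   Context: Notation: $\psi^{ij}_k:V\otimes V\to V$ is the linear map with $\psi^{ij}_k(v_a\otimes v_b)=v_k$ if $(a,b)=(i,j)$ and $0$ otherwise. A codifferential of degree 2 on $V$ is an odd linear map $d:V\otimes V\to V$ such that for all homogeneous $a,b,c$, $d(d(a,b),c)+(-1)^{|a|}d(a,d(b,c))=0$. Two codifferentials $d,d'$ are equivalent if $d'=g^{-1}\circ d\circ(g\otimes g)$ for some even linear automorphism $g$ of $V$. A jump deformation from $d$ to $d'$ is a one-parameter family of deformations $d_t$ of $d$ (with $d_0=d$) such that $d_t$ is equivalent to $d'$ for every small $t\ne0$. Deformations: a formal base is a (purely even) commutative unital $\mathbb{C}$-algebra $A$ with an augmentation $A\to\mathbb{C}$ whose kernel $\mathfrak m$ is the unique maximal ideal of $A$ (so $A=\mathbb{C}\oplus\mathfrak m$), and which is complete, $A=\varprojlim_k A/\mathfrak m^k$; it is infinitesimal if $\mathfrak m^2=0$. A deformation of $d$ with base $A$ is $d_A=d+\varphi$ with $\varphi:V\otimes V\to V\otimes\mathfrak m$ odd and $d_A$ (extended $A$-linearly) satisfying the codifferential identity. Deformations $d_A,d_A'$ are equivalent ($d_A\sim d'_A$) if $d_A'=g^{-1}\circ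 d_A\circ(g\otimes g)$ for some $A$-linear automorphism $g=I+\lambda$ with $\lambda:V\to V\otimes\mathfrak m$ even. A morphism $f:A\to B$ of augmented algebras pushes $d_A$ forward to $f_*(d_A)=(1\otimes f)d_A$. A deformation $d_A$ with formal base is versal if for every deformation $d_B$ with formal base $B$ there is a morphism $f:A\to B$ with $f_*(d_A)\sim d_B$; it is miniversal if moreover $f$ is unique whenever $B$ is infinitesimal. *)

(* Defs.v *)
From HB Require Import structures.
From mathcomp Require Import all_boot all_order all_algebra ring_quotient complex.
From mathcomp Require Import boolp classical_sets reals topology mpoly.

Set Implicit Arguments.
Unset Strict Implicit.
Unset Printing Implicit Defensive.
Import GRing.Theory Num.Theory.
Import numFieldTopology.Exports.
Local Open Scope ring_scope.
Local Open Scope classical_set_scope.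

(* K[[t_1, ..., t_n]]: a power series is the family of its coefficients,
   indexed by monomials. *)
Definition fps (K : comNzRingType) (n : nat) : Type := 'X_{1..n} -> K.

Section PowerSeries.
Variables (K : comNzRingType) (n : nat).
Local Notation F := (fps K n).
Implicit Types (f g h : F) (m : 'X_{1..n}).

HB.instance Definition _ := gen_eqMixin F.
HB.instance Definition _ := gen_choiceMixin F.

Definition fps_const (a : K) : F := fun m => if m == 0%MM then a else 0.
Definition fps_add f g : F := fun m => f m + g m.
Definition fps_opp f : F := fun m => - f m.
Definition fps_mul f g : F := fun m =>
  \sum_(k : 'X_{1..n < (mdeg m).+1, (mdeg m).+1} | m == (k.1 + k.2)%MM)
    f k.1 * g k.2.
Definition fps_scale (a : K) f : F := fun m => a * f m.
Definition fps_var (i : 'I_n) : F := fun m => (m == U_(i)%MM)%:R.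

Fact fps_addA : associative fps_add.
Proof. by move=> f g h; apply/funext => m; rewrite /fps_add addrA. Qed.
Fact fps_addC : commutative fps_add.
Proof. by move=> f g; apply/funext => m; rewrite /fps_add addrC. Qed.
Fact fps_add0 : left_id (fps_const 0) fps_add.
Proof. by move=> f; apply/funext => m; rewrite /fps_add /fps_const if_same add0r. Qed.
Fact fps_addN : left_inverse (fps_const 0) fps_opp fps_add.
Proof.
by move=> f; apply/funext => m; rewrite /fps_add /fps_opp /fps_const if_same addNr.
Qed.

HB.instance Definition _ :=
  GRing.isZmodule.Build F fps_addA fps_addC fps_add0 fps_addN.

Let trunc (d : nat) f : {mpoly K[n]} := \sum_(k : 'X_{1..n < d}) f k *: 'X_[k].

Let mcoeff_trunc d f m : (mdeg m < d)%N -> (trunc d f)@_m = f m.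
Proof.
move=> md; rewrite /trunc raddf_sum /= (bigD1 (BMultinom md)) //=.
rewrite mcoeffZ mcoeffX eqxx mulr1 big1 ?addr0 // => k ne.
rewrite mcoeffZ mcoeffX; case: eqP => [e|_]; last by rewrite mulr0.
by move: ne; rewrite bmeqP /= e eqxx.
Qed.

Let fps_mulE d f g m : (mdeg m < d)%N ->
  fps_mul f g m = (trunc d f * trunc d g)@_m.
Proof.
move=> md; rewrite mcoeffM; apply: eq_bigr => k _.
by rewrite !mcoeff_trunc // (leq_trans (bmdeg _)).
Qed.

Let mcoeffM_eq (p p' q q' : {mpoly K[n]}) m :
    (forall k, (mdeg k <= mdeg m)%N -> p@_k = p'@_k) ->
    (forall k, (mdeg k <= mdeg m)%N -> q@_k = q'@_k) ->
  (p * q)@_m = (p' * q')@_m.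
Proof.
move=> ep eq; rewrite !mcoeffM; apply: eq_bigr => k _.
by rewrite ep ?eq // -ltnS bmdeg.
Qed.

Fact fps_mulA : associative fps_mul.
Proof.
move=> f g h; apply/funext => m; set d := (mdeg m).+1.
rewrite !(fps_mulE (d := d)) //.
rewrite (mcoeffM_eq (p' := trunc d f) (q' := trunc d g * trunc d h)) //; last first.
  by move=> k km; rewrite mcoeff_trunc // (fps_mulE (d := d)).
rewrite mulrA; apply: mcoeffM_eq => // k km.
by rewrite mcoeff_trunc // (fps_mulE (d := d)).
Qed.
Fact fps_mulC : commutative fps_mul.
Proof.
move=> f g; apply/funext => m.
by rewrite !(fps_mulE (d := (mdeg m).+1)) // mulrC.
Qed.
Let mulC1 (a : K) f m : fps_mul (fps_const a) f m = a * f m.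
Proof.
rewrite (fps_mulE (d := (mdeg m).+1)) //.
have -> : trunc (mdeg m).+1 (fps_const a) = a%:MP.
  apply/mpolyP => k; rewrite mcoeffC.
  case: (ltnP (mdeg k) (mdeg m).+1) => km.
    by rewrite mcoeff_trunc // /fps_const; case: eqP; rewrite ?(mulr1, mulr0).
  rewrite /trunc raddf_sum /= big1 => [|j _].
    by case: eqP km => [->|_]; rewrite ?mdeg0 // mulr0.
  rewrite mcoeffZ mcoeffX; case: eqP => [e|_]; last by rewrite mulr0.
  by move: km; rewrite -e leqNgt bmdeg.
by rewrite mul_mpolyC mcoeffZ mcoeff_trunc.
Qed.
Fact fps_mul1 : left_id (fps_const 1) fps_mul.
Proof. by move=> f; apply/funext => m; rewrite mulC1 mul1r. Qed.
Fact fps_mulDl : left_distributive fps_mul fps_add.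
Proof.
move=> f g h; apply/funext => m; rewrite /fps_add /fps_mul -big_split /=.
by apply: eq_bigr => k _; rewrite mulrDl.
Qed.
Fact fps_1neq0 : fps_const 1 != 0 :> F.
Proof.
apply/eqP => e; have: fps_const 1 0%MM = fps_const 0 0%MM :> K by rewrite e.
by rewrite /fps_const eqxx => /eqP; rewrite oner_eq0.
Qed.

HB.instance Definition _ := GRing.Zmodule_isComNzRing.Build F
  fps_mulA fps_mulC fps_mul1 fps_mulDl fps_1neq0.

Fact fps_scaleA a b f : fps_scale a (fps_scale b f) = fps_scale (a * b) f.
Proof. by apply/funext => m; rewrite /fps_scale mulrA. Qed.
Fact fps_scale1 : left_id 1 fps_scale.
Proof. by move=> f; apply/funext => m; rewrite /fps_scale mul1r. Qed.
Fact fps_scaleDr : right_distributive fps_scale +%R.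
Proof. by move=> a f g; apply/funext => m; rewrite /fps_scale mulrDr. Qed.
Fact fps_scaleDl f : {morph fps_scale^~ f : a b / a + b}.
Proof. by move=> a b; apply/funext => m; rewrite /fps_scale mulrDl. Qed.
HB.instance Definition _ := GRing.Zmodule_isLmodule.Build K F
  fps_scaleA fps_scale1 fps_scaleDr fps_scaleDl.
Fact fps_scaleAl (a : K) f g : a *: (f * g) = a *: f * g.
Proof.
have -> : a *: f = fps_mul (fps_const a) f by apply/funext => m; rewrite mulC1.
by rewrite -[RHS]fps_mulA; apply/funext => m; rewrite mulC1.
Qed.
HB.instance Definition _ := GRing.Lmodule_isLalgebra.Build K F fps_scaleAl.
HB.instance Definition _ := GRing.Lalgebra_isComAlgebra.Build K F.

Definition fps_eval0 (f : F) : K^o := f 0%MM.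

Fact fps_eval01 : fps_eval0 1 = 1.
Proof. by rewrite /fps_eval0 /GRing.one /= /fps_const eqxx. Qed.
Fact fps_eval0_mul f g : fps_eval0 (f * g) = fps_eval0 f * fps_eval0 g.
Proof.
transitivity ((trunc 1 f * trunc 1 g)@_0); first by apply: fps_mulE; rewrite mdeg0.
by rewrite rmorphM /= !mcoeff_trunc ?mdeg0.
Qed.

HB.instance Definition _ := GRing.isZmodMorphism.Build F K^o fps_eval0
  (fun f g => erefl).
HB.instance Definition _ := GRing.isMonoidMorphism.Build F K^o fps_eval0
  (fps_eval01, fps_eval0_mul).
HB.instance Definition _ := GRing.isScalable.Build K F K^o *:%R fps_eval0
  (fun a f => erefl).

End PowerSeries.

Section QuotientAlgebra.
Variables (K : nzRingType) (A : comAlgType K) (I : idealr A).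
Local Notation Q := {ideal_quot I}.
Local Open Scope quotient_scope.

Definition quot_scale (a : K) (x : Q) : Q := \pi_Q a%:A * x.

Fact quot_scaleA a b x : quot_scale a (quot_scale b x) = quot_scale (a * b) x.
Proof. by rewrite /quot_scale mulrA -rmorphM -scalerAl mul1r scalerA. Qed.
Fact quot_scale1 : left_id 1 quot_scale.
Proof. by move=> x; rewrite /quot_scale scale1r rmorph1 mul1r. Qed.
Fact quot_scaleDr : right_distributive quot_scale +%R.
Proof. by move=> a x y; rewrite /quot_scale mulrDr. Qed.
Fact quot_scaleDl x : {morph quot_scale^~ x : a b / a + b}.
Proof. by move=> a b; rewrite /quot_scale scalerDl rmorphD mulrDl. Qed.
HB.instance Definition _ := GRing.Zmodule_isLmodule.Build K Q
  quot_scaleA quot_scale1 quot_scaleDr quot_scaleDl.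
Fact quot_scaleAl (a : K) (x y : Q) : a *: (x * y) = a *: x * y.
Proof. by rewrite /GRing.scale /= /quot_scale mulrA. Qed.
HB.instance Definition _ := GRing.Lmodule_isLalgebra.Build K Q quot_scaleAl.
HB.instance Definition _ := GRing.Lalgebra_isComAlgebra.Build K Q.

End QuotientAlgebra.

Definition gen_ideal (A : comNzRingType) (s : seq A) : {pred A} :=
  fun x => `[< exists c : 'I_(size s) -> A, x = \sum_i c i * s`_i >].

Fact gen_ideal_idealr (A : comNzRingType) (s : seq A) :
  1 \notin gen_ideal s -> idealr_closed (gen_ideal s).
Proof.
move=> s1; split=> // [|a u v /asboolP[c ->] /asboolP[c' ->]]; apply/asboolP.
  by exists (fun=> 0); rewrite big1 // => i _; rewrite mul0r.
exists (fun i => a * c i + c' i); rewrite mulr_sumr -big_split /=.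
by apply: eq_bigr => i _; rewrite mulrDl mulrA.
Qed.

Record augAlg (K : nzRingType) := AugAlg {
  aug_alg :> comAlgType K;
  aug : {lrmorphism aug_alg -> K^o}
}.

Section FormalBases.
Variable K : nzRingType.
Implicit Types A B : augAlg K.

Definition aug_ideal A : set A := [set x | aug A x = 0].

Definition is_ideal (A : comNzRingType) (J : set A) :=
  [/\ J 0, forall x y, J x -> J y -> J (x + y) & forall a x, J x -> J (a * x)].

Definition maximal_ideal (A : comNzRingType) (J : set A) :=
  [/\ is_ideal J, J <> setT &
      forall I : set A, is_ideal I -> J `<=` I -> I = J \/ I = setT].

Fixpoint ideal_exp (A : comNzRingType) (J : set A) (k : nat) : set A :=
  if k is k'.+1 then
    [set x | exists s : seq (A * A),
       (forall u, u \in s -> J u.1 /\ ideal_exp J k' u.2) /\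
       x = \sum_(u <- s) u.1 * u.2]
  else setT.

(* The canonical map A -> lim_k A / J^k is injective and surjective. *)
Definition adically_complete (A : comNzRingType) (J : set A) :=
  (forall x, (forall k, ideal_exp J k x) -> x = 0) /\
  (forall a : nat -> A, (forall k, ideal_exp J k (a k.+1 - a k)) ->
     exists x, forall k, ideal_exp J k (x - a k)).

Definition formal_base A :=
  [/\ maximal_ideal (@aug_ideal A),
      forall J : set A, maximal_ideal J -> J = @aug_ideal A &
      adically_complete (@aug_ideal A)].

Definition infinitesimal A :=
  forall x y : A, aug_ideal x -> aug_ideal y -> x * y = 0.

Definition aug_morphism A B (f : {lrmorphism A -> B}) :=
  forall x, aug B (f x) = aug A x.

End FormalBases.

(* V_A = V (x) A is 'rV[A]_3: the ordinals 0, 1, 2 stand for v_1, v_2, v_3, and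
   only v_3 is odd. A linear map V (x) V -> V (x) A is given by the images
   d (i, j) of the v_i (x) v_j. *)
Definition cochain (A : nzRingType) := {ffun 'I_3 * 'I_3 -> 'rV[A]_3}.

Definition parity (i : 'I_3) : bool := i == 2 :> nat.

Definition homogeneous (A : nzRingType) (p : bool) (x : 'rV[A]_3) :=
  forall i, parity i != p -> x 0 i = 0.

(* v_i (x) v_j |-> v_k, with one-based indices. *)
Definition psi {A : nzRingType} (i j k : nat) : cochain A :=
  [ffun ab : 'I_3 * 'I_3 => \row_(c < 3) ((ab.1.+1 == i) && (ab.2.+1 == j) && (c.+1 == k))%:R].

Section Codifferentials.
Variable A : comNzRingType.
Implicit Types (d : cochain A) (g : 'M[A]_3) (x y z : 'rV[A]_3).

(* The A-bilinear extension of d. *)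
Definition ext d x y : 'rV[A]_3 := \sum_i \sum_j (x 0 i * y 0 j) *: d (i, j).

Definition odd_cochain d := forall p q x y,
  homogeneous p x -> homogeneous q y -> homogeneous (~~ (p (+) q)) (ext d x y).

Definition codifferential d := odd_cochain d /\
  forall p q r x y z, homogeneous p x -> homogeneous q y -> homogeneous r z ->
    ext d (ext d x y) z + (-1) ^+ p *: ext d x (ext d y z) = 0.

(* A matrix g stands for the endomorphism x |-> x *m g. *)
Definition even_mx g := forall p x, homogeneous p x -> homogeneous p (x *m g).

Definition transports g g' d d' := [/\ g *m g' = 1%:M, g' *m g = 1%:M &
  forall x y, ext d' x y = ext d (x *m g) (y *m g) *m g'].

Definition codiff_equiv d d' := exists g g', even_mx g /\ transports g g' d d'.

End Codifferentials.

Section Deformations.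
Variable K : comNzRingType.
Implicit Types (A B : augAlg K) (d : cochain K).

Definition deformation d A (dA : cochain A) :=
  exists phi : cochain A,
    [/\ forall ij k, aug_ideal (phi ij 0 k), odd_cochain phi,
        dA = [ffun ij => map_mx (in_alg A) (d ij)] + phi & codifferential dA].

Definition def_equiv A (dA dA' : cochain A) := exists L g' : 'M[A]_3,
  [/\ forall i j, aug_ideal (L i j), even_mx L & transports (1%:M + L) g' dA dA'].

Definition pushforward A B (f : A -> B) (dA : cochain A) : cochain B :=
  [ffun ij => map_mx f (dA ij)].

Definition versal d A (dA : cochain A) :=
  [/\ formal_base A, deformation d dA &
      forall B (dB : cochain B), formal_base B -> deformation d dB ->
        exists f : {lrmorphism A -> B},
          aug_morphism f /\ def_equiv (pushforward f dA) dB].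

Definition miniversal d A (dA : cochain A) := versal d dA /\
  forall B (dB : cochain B), formal_base B -> infinitesimal B ->
    deformation d dB -> forall f f' : {lrmorphism A -> B},
      aug_morphism f -> def_equiv (pushforward f dA) dB ->
      aug_morphism f' -> def_equiv (pushforward f' dA) dB -> f =1 f'.

End Deformations.

Section Jumps.
Variable K : numFieldType.

Definition analytic_at0 (f : K -> K) := exists c : nat -> K,
  \forall t \near (0 : K^o),
    (fun n => \sum_(k < n) c k * t ^+ k : K^o) @ \oo --> (f t : K^o).

Definition jump_deformation (d d' : cochain K) (D : K -> cochain K) :=
  [/\ forall ij k, analytic_at0 (fun t => D t ij 0 k),
      D 0 = d,
      \forall t \near (0 : K^o), codifferential (D t) &
      \forall t \near (0 : K^o), t != 0 -> codiff_equiv (D t) d'].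

End Jumps.

Section Family.
Variable A : comNzRingType.
Implicit Types p q t : A.

Definition d1 : cochain A := psi 2 3 2 - psi 3 2 2 + psi 2 2 3 - psi 3 3 3.
Definition d12 : cochain A := psi 2 2 3 + psi 2 3 1 - psi 3 2 1.
Definition d13 p q : cochain A := psi 2 2 3 + p *: psi 2 1 3 + q *: psi 1 2 3.

Definition dinf t1 t2 t3 t4 : cochain A :=
  psi 2 2 3 + t4 *: psi 1 1 3 + t3 *: psi 2 1 3 + t2 *: psi 3 3 3
  - t1 *: psi 2 3 1 + (t1 * t3) *: psi 3 1 1 + t1 *: psi 3 2 1
  - (t2 * t3) *: psi 1 3 2 + (- t2 + t1 * t3) *: psi 2 3 2
  + (t1 * t4 + t2 * t3 - 2%:R * t3 ^+ 2 * t1) *: psi 3 1 2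
  + (t2 - 2%:R * t1 * t3) *: psi 3 2 2.

Definition relations t1 t2 t3 t4 : seq A :=
  [:: t1 * t4 - t2 * t3;
      t1 * (2%:R * t3 ^+ 2 - t4);
      t1 * t3;
      (2%:R * t1 * t3 - t2) * (t4 - t3 ^+ 2);
      t1 * (t4 - t3);
      t1 * t4;
      t1 * t3;
      t1 * t3 * t4;
      t1 * t4 + t2 * t3 - 2%:R * t1 * t3 ^+ 2].

End Family.
Arguments d1 {A}.
Arguments d12 {A}.

Section Base.
Variable K : comNzRingType.
Local Notation S := (fps K 4).
(* Indices are zero-based here: t i is the variable t_(i+1). *)
Let t (i : 'I_4) : S := fps_var K i.

Definition base_ideal : {pred S} :=
  gen_ideal (relations (t 0) (t 1) (t 2%:R) (t 3%:R)).

Fact base_ideal_eval0 f : f \in base_ideal -> fps_eval0 f = 0.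
Proof.
have t0 i : fps_eval0 (t i) = 0.
  rewrite /fps_eval0 /t /fps_var; case: eqP => // /(congr1 (@mdeg _)).
  by rewrite mdeg0 mdeg1.
have evB (g h : S) : fps_eval0 (g - h) = fps_eval0 g - fps_eval0 h by [].
have evD (g h : S) : fps_eval0 (g + h) = fps_eval0 g + fps_eval0 h by [].
have tM i x : fps_eval0 (t i * x) = 0 by rewrite fps_eval0_mul t0 mul0r.
move/asboolP => [c ->]; rewrite raddf_sum big1 // => i _ /=.
rewrite fps_eval0_mul; suff -> : fps_eval0 (relations (t 0) (t 1) (t 2%:R) (t 3%:R))`_i = 0.
  by rewrite mulr0.
case: i => i /= _; do 9?[case: i => [|i] /=]; rewrite ?nth_nil ?raddf0 //.
all: rewrite -?mulrA ?(mulrCA 2%:R) ?fps_eval0_mul ?evB ?evD ?tM ?t0 //.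
all: by rewrite ?(subrr, addr0, subr0, mul0r).
Qed.

Fact base_ideal_idealr : idealr_closed base_ideal.
Proof.
apply: gen_ideal_idealr; apply/negP => /base_ideal_eval0/eqP.
by rewrite rmorph1 oner_eq0.
Qed.
HB.instance Definition _ := isIdealr.Build S base_ideal base_ideal_idealr.

Definition base_alg : comAlgType K := {ideal_quot base_ideal}.
Definition base_pi (f : S) : base_alg := \pi_({ideal_quot base_ideal})%qT f.

Definition base_aug (x : base_alg) : K^o := fps_eval0 (repr (x : {ideal_quot base_ideal})).

Fact base_aug_pi f : base_aug (base_pi f) = fps_eval0 f.
Proof.
apply/eqP; rewrite -subr_eq0 -raddfB; apply/eqP/base_ideal_eval0.
by rewrite Quotient.idealrBE reprK.
Qed.

Fact base_piP (x : base_alg) : exists f, x = base_pi f.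
Proof. by exists (repr (x : {ideal_quot base_ideal})); rewrite /base_pi reprK. Qed.

Fact base_piB f g : base_pi f - base_pi g = base_pi (f - g).
Proof. by rewrite /base_pi [in RHS]rmorphB. Qed.
Fact base_pi1 : base_pi 1 = 1.
Proof. by rewrite /base_pi rmorph1. Qed.
Fact base_piM f g : base_pi f * base_pi g = base_pi (f * g).
Proof. by rewrite /base_pi [in RHS]rmorphM. Qed.
Fact base_piZ a f : a *: base_pi f = base_pi (a *: f).
Proof. by rewrite -[f in RHS]mul1r scalerAl -base_piM. Qed.

Fact base_aug_zmod : zmod_morphism base_aug.
Proof.
move=> x y; have [f ->] := base_piP x; have [g ->] := base_piP y.
by rewrite base_piB !base_aug_pi.
Qed.
Fact base_aug_monoid : monoid_morphism base_aug.
Proof.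
split=> [|x y]; first by rewrite -base_pi1 base_aug_pi rmorph1.
have [f ->] := base_piP x; have [g ->] := base_piP y.
by rewrite base_piM !base_aug_pi fps_eval0_mul.
Qed.
Fact base_aug_scalable : scalable base_aug.
Proof.
by move=> a x; have [f ->] := base_piP x; rewrite base_piZ !base_aug_pi.
Qed.
HB.instance Definition _ :=
  GRing.isZmodMorphism.Build base_alg K^o base_aug base_aug_zmod.
HB.instance Definition _ :=
  GRing.isMonoidMorphism.Build base_alg K^o base_aug base_aug_monoid.
HB.instance Definition _ :=
  GRing.isScalable.Build K base_alg K^o *:%R base_aug base_aug_scalable.

Definition base : augAlg K := AugAlg (base_aug : {lrmorphism base_alg -> K^o}).

Definition dinf_base : cochain base :=
  dinf (base_pi (t 0)) (base_pi (t 1)) (base_pi (t 2%:R)) (base_pi (t 3%:R)).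

End Base.

Section Loci.
Variable K : fieldType.

Definition vec4 (t1 t2 t3 t4 : K) : 'rV[K]_4 :=
  \row_(i < 4) [:: t1; t2; t3; t4]`_i.

Definition solution (t1 t2 t3 t4 : K) :=
  forall r, r \in relations t1 t2 t3 t4 -> r = 0.

End Loci.

(* Main.v *)
From HB Require Import structures.
Require Import Defs.
From mathcomp Require Import all_boot all_order all_algebra complex.
From mathcomp Require Import ring_quotient ring mpoly.
From mathcomp Require Import boolp classical_sets reals topology.
Import GRing.Theory Num.Theory.
Import numFieldTopology.Exports.
Local Open Scope ring_scope.
Local Open Scope classical_set_scope.
Set Implicit Arguments.
Unset Strict Implicit.
Unset Printing Implicit Defensive.

(* An odd cochain on the 2|1-dimensional space consists of a bilinear form on the even part
   (with values in v_3), the left and right multiplications by v_3 on the even part, and a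
   scalar. In a deformation of psi^{22}_3 the value of the form at (v_2, v_2) is a unit, so
   rescaling v_3 and adding a multiple of v_2 to v_1 bring its matrix to the shape
   ((t_4, 0), (t_3, 1)). The codifferential identity then determines everything else from
   d(v_3, v_2) = t_1 v_1 + t_2 v_2, and what is left of it is t_1 t_3 = t_1 t_4 = t_2 t_3 =
   t_2 t_4 = 0, which generates the ideal of the nine relations. Versality is therefore the
   universal property of a quotient of C[[t_1, ..., t_4]] among complete algebras.
   Over an infinitesimal base the t_i can be read off from any equivalent deformation, which
   gives uniqueness; completeness of the base holds because the ideal is monomial. *)

(** * Complete augmented algebras *)


Section IdealPowers.
Variables (A : comNzRingType) (J : set A).
Hypothesis idJ : is_ideal J.

Lemma is_idealN x : J x -> J (- x).
Proof. by case: idJ => _ _ JM Jx; rewrite -mulN1r; apply: JM. Qed.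

Lemma is_ideal_sum (I : Type) (r : seq I) (P : pred I) (F : I -> A) :
  (forall i, P i -> J (F i)) -> J (\sum_(i <- r | P i) F i).
Proof. by move=> JF; apply: big_ind => //; case: idJ. Qed.

End IdealPowers.

Lemma ideal_exp_is_ideal (A : comNzRingType) (J : set A) k :
  is_ideal J -> is_ideal (ideal_exp J k).
Proof.
move=> [J0 JD JM]; case: k => [|k]; first by split.
split=> [|_ _ [s [sJ ->]] [s' [s'J ->]]|a _ [s [sJ ->]]].
- by exists [::]; rewrite big_nil.
- exists (s ++ s'); rewrite big_cat; split=> // u.
  by rewrite mem_cat => /orP[/sJ|/s'J].
- exists [seq (a * u.1, u.2) | u <- s]; split; last first.
    by rewrite big_map mulr_sumr; apply: eq_bigr => u _; rewrite mulrA.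
  by move=> _ /mapP[u /sJ[Ju1 Ju2] ->]; split=> //; apply: JM.
Qed.

Lemma ideal_expM (A : comNzRingType) (J : set A) k x y :
  J x -> ideal_exp J k y -> ideal_exp J k.+1 (x * y).
Proof.
by move=> Jx Jy; exists [:: (x, y)]; rewrite big_seq1; split=> // u; rewrite inE => /eqP->.
Qed.

Lemma ideal_expW (A : comNzRingType) (J : set A) k l x :
  is_ideal J -> (k <= l)%N -> ideal_exp J l x -> ideal_exp J k x.
Proof.
move=> idJ /subnK <-; elim: (l - k)%N x => // n IHn x [s [sJ ->]].
have idJk := ideal_exp_is_ideal k idJ.
rewrite big_seq; apply: is_ideal_sum => // u /sJ[_ /IHn]; by case: idJk => _ _; apply.
Qed.

Lemma ideal_exp_addn (A : comNzRingType) (J : set A) k l x y :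
  is_ideal J -> ideal_exp J k x -> ideal_exp J l y -> ideal_exp J (k + l) (x * y).
Proof.
move=> idJ; elim: k x => [|k IHk] x.
  by move=> _; case: (ideal_exp_is_ideal l idJ) => _ _; apply.
move=> [s [sJ ->]] Jy; rewrite mulr_suml big_seq.
apply: is_ideal_sum; first exact: ideal_exp_is_ideal.
by move=> u /sJ[Ju1 Ju2]; rewrite -mulrA; apply: ideal_expM => //; apply: IHk.
Qed.

Lemma ideal_expX (A : comNzRingType) (J : set A) k x : J x -> ideal_exp J k (x ^+ k).
Proof. by move=> Jx; elim: k => // k IHk; rewrite exprS; apply: ideal_expM. Qed.

Section CompleteAlgebras.
Variables (K : fieldType) (A : augAlg K).
Local Notation m := (@aug_ideal K A).

Lemma aug_ideal_is_ideal : is_ideal m.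
Proof.
rewrite /aug_ideal; split=> [|x y|a x] /=; first exact: raddf0.
  by rewrite raddfD /= => -> ->; rewrite addr0.
by rewrite rmorphM /= => ->; rewrite mulr0.
Qed.

Hypothesis cA : adically_complete m.

Lemma adic_separated x y : (forall k, ideal_exp m k (x - y)) -> x = y.
Proof. by case: cA => sep _ /sep/eqP; rewrite subr_eq0 => /eqP. Qed.

(** The inverse is the limit of the partial sums of the geometric series in [- x]. *)
Lemma aug_ideal_unit1D x : m x -> exists y, (1 + x) * y = 1.
Proof.
move=> mx; have mX k : ideal_exp m k ((- x) ^+ k).
  by apply: ideal_expX; apply: is_idealN mx; exact: aug_ideal_is_ideal.
have [y yP] : exists y, forall k, ideal_exp m k (y - \sum_(i < k) (- x) ^+ i).
  by case: cA => _; apply => k; rewrite big_ord_recr /= addrAC subrr add0r.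
exists y; apply: adic_separated => k.
have [_ mD mM] := ideal_exp_is_ideal k aug_ideal_is_ideal.
set s := \sum_(i < k) (- x) ^+ i in yP *.
(* Both terms lie in m^k: [y - s] by the choice of [y], and [(- x) ^+ k] because [x] is in m. *)
have -> : (1 + x) * y - 1 = (1 + x) * (y - s) + - (- x) ^+ k.
  suff : (1 + x) * s = 1 - (- x) ^+ k by move=> E; rewrite mulrBr E; ring.
  by rewrite -[RHS]opprB subrX1 -/s; ring.
apply: mD; first exact: mM.
by apply: is_idealN; first exact: (ideal_exp_is_ideal k aug_ideal_is_ideal).
Qed.

Lemma aug_unit x : aug A x != 0 -> exists y, x * y = 1.
Proof.
move=> x0; set c := aug A x in x0.
have [|y Ey] := @aug_ideal_unit1D (c^-1 *: x - 1).
  have cx : aug A (c^-1 *: x) = 1 by rewrite linearZZ /= -/c; exact: mulVf.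
  by rewrite /aug_ideal /= raddfB /= cx rmorph1 subrr.
by exists (c^-1 *: y); rewrite -Ey -scalerAr addrC subrK scalerAl.
Qed.

(** By [aug_unit] everything outside m is a unit, so an ideal is either the whole algebra or
    contained in m. Maximality and uniqueness both come from this dichotomy. *)
Lemma complete_formal_base : formal_base A.
Proof.
have idm := aug_ideal_is_ideal.
have m1 : ~ m 1 by rewrite /aug_ideal /= rmorph1; apply/eqP; rewrite oner_eq0.
have full (I : set A) x : is_ideal I -> I x -> aug A x != 0 -> I = setT.
  move=> [_ _ IM] Ix /aug_unit[y Exy]; apply/seteqP; split=> // z _.
  by rewrite -[z]mulr1 -Exy (mulrC x) mulrA; apply: IM.
have maxm (I : set A) : is_ideal I -> I = setT \/ I `<=` m.
  move=> idI; have [|nI] := pselect (exists2 x, I x & aug A x != 0).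
    by move=> [x Ix x0]; left; apply: full x0.
  right=> x Ix; rewrite /aug_ideal /=; apply/eqP/negP => /negP x0.
  by apply: nI; exists x.
split=> //.
  split=> // [mT|I idI mI]; first by apply: m1; rewrite mT.
  have [->|Im] := maxm I idI; first by right.
  by left; apply/seteqP; split.
move=> J [idJ JT Jmax]; have [//|Jm] := maxm J idJ.
have [->//|mT] := Jmax m idm Jm.
by case: m1; rewrite mT.
Qed.

End CompleteAlgebras.

(** * Power series *)

Section PowerSeriesCoefficients.
Variables (K : comNzRingType) (n : nat).
Implicit Types (f g : fps K n) (u m : 'X_{1..n}) (p : {mpoly K[n]}).

Definition fps_trunc k f : {mpoly K[n]} := \sum_(m : 'X_{1..n < k}) f m *: 'X_[m].

Lemma mcoeff_trunc k f m : (mdeg m < k)%N -> (fps_trunc k f)@_m = f m.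
Proof. exact: mcoeff_mpoly. Qed.

Lemma fps_subE f g m : (f - g) m = f m - g m. Proof. by []. Qed.

Lemma fps_sumE (I : Type) (r : seq I) (P : pred I) (F : I -> fps K n) m :
  (\sum_(i <- r | P i) F i) m = \sum_(i <- r | P i) F i m.
Proof.
apply: (big_morph (fun f : fps K n => f m)) => //.
by rewrite /GRing.zero /= /fps_const if_same.
Qed.

Lemma fps_1E m : (1 : fps K n) m = (m == 0%MM)%:R.
Proof. by rewrite /GRing.one /= /fps_const; case: eqP. Qed.

Lemma fps_scaleE a f m : (a *: f) m = a * f m. Proof. by []. Qed.

Lemma fps_mulE f g m : (f * g) m =
  \sum_(k : 'X_{1..n < (mdeg m).+1, (mdeg m).+1} | m == (k.1 + k.2)%MM) f k.1 * g k.2.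
Proof. by []. Qed.

Lemma fps_mul_mpoly k p q f g :
    (forall m, (mdeg m < k)%N -> p@_m = f m) ->
    (forall m, (mdeg m < k)%N -> q@_m = g m) ->
  forall m, (mdeg m < k)%N -> (p * q)@_m = (f * g) m.
Proof.
move=> ep eq m mk; rewrite mcoeffM fps_mulE; apply: eq_bigr => u _.
by rewrite ep ?eq //; apply: leq_trans mk; apply: bmdeg.
Qed.

Definition fps_mono u : fps K n := fun m => (m == u)%:R.

Lemma fps_mono_mulE u g m : (fps_mono u * g) m = if (u <= m)%MM then g (m - u)%MM else 0.
Proof.
rewrite fps_mulE; case: ifP => [um|num]; last first.
  rewrite big1 // => k /eqP mE; rewrite /fps_mono; case: eqP => [ku|_]; last by rewrite mul0r.
  by move: num; rewrite [X in (_ <= X)%MM]mE ku lem_addr.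
have mu : (mdeg u < (mdeg m).+1)%N by rewrite ltnS -(submK um) mdegD leq_addl.
have mmu : (mdeg (m - u)%MM < (mdeg m).+1)%N by rewrite ltnS -{2}(submK um) mdegD leq_addr.
rewrite (bigD1 (BMultinom mu, BMultinom mmu)) /=; last by rewrite addmC submK.
rewrite /fps_mono eqxx mul1r big1 ?addr0 // => -[k1 k2] /= /andP[/eqP mE].
case: (eqVneq (k1 : 'X_{1..n}) u) => [ku|]; last by rewrite mul0r.
case/eqP; congr pair; apply/eqP; rewrite bmeqP /= ?ku //.
by rewrite [X in (X - _)%MM]mE ku addmC addmK.
Qed.

Lemma fps_monoM u v : fps_mono u * fps_mono v = fps_mono (u + v)%MM.
Proof.
apply/funext => m; rewrite fps_mono_mulE /fps_mono; case: ifP => [um|num].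
  congr ((nat_of_bool _)%:R); apply/eqP/eqP => [<-|->]; first by rewrite addmC submK.
  by rewrite addmC addmK.
by case: eqP num => // ->; rewrite lem_addr.
Qed.

(** The generators of the monomial ideal are divided out one at a time. The last clause lets
    vanishing of [f] in low degrees pass to the cofactors. *)
Lemma fps_mono_span (s : seq 'X_{1..n}) f :
    (forall m, f m != 0 -> has (fun u => (u <= m)%MM) s) ->
  exists g : nat -> fps K n, f = \sum_(i < size s) fps_mono (nth 0%MM s i) * g i /\
    forall i m, g i m = 0 \/ g i m = f (m + nth 0%MM s i)%MM.
Proof.
elim: s f => [|u s IHs] f fs.
  (* With no generators left [f] vanishes and can serve as its own cofactor. *)
  exists (fun=> f); split; last first.
    by move=> i m; left; case: (eqVneq (f m) 0) => // /fs.
  by rewrite big_ord0; apply/funext => m; case: (eqVneq (f m) 0) => [->|/fs //];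
    rewrite /GRing.zero /= /fps_const if_same.
(* [g0] collects the terms of [f] divisible by [u], divided by [u]; what remains is supported on
   multiples of the other generators. *)
pose g0 : fps K n := fun m => f (m + u)%MM.
have fE m : (f - fps_mono u * g0) m = if (u <= m)%MM then 0 else f m.
  rewrite fps_subE fps_mono_mulE; case: ifP => [um|_]; last by rewrite subr0.
  by rewrite /g0 submK // subrr.
have [m|g [fg gf]] := IHs (f - fps_mono u * g0).
  by rewrite fE; case: ifP => [|um /fs]; rewrite ?eqxx //= um.
exists (fun i => if i is i'.+1 then g i' else g0); split.
  by rewrite big_ord_recl /= -fg addrC subrK.
move=> [|i] m /=; first by right.
by have [->|->] := gf i m; [left|rewrite fE; case: ifP; [left|right]].
Qed.

Lemma fps_gen_span f : f 0%MM = 0 ->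
  exists g : 'I_n -> fps K n, f = \sum_i fps_var K i * g i /\
    forall i m, g i m = 0 \/ g i m = f (m + U_(i))%MM.
Proof.
move=> f0; pose s := [seq U_(i)%MM | i <- enum 'I_n].
have sz : size s = n by rewrite size_map size_enum_ord.
have nthE (i : 'I_n) : nth 0%MM s i = U_(i)%MM.
  by rewrite (nth_map i) ?size_enum_ord // nth_ord_enum.
have [m fm|g [fg gf]] := @fps_mono_span s f.
  have : m != 0%MM by apply: contraNneq fm => ->; rewrite f0.
  rewrite -mdeg_eq0 mdegE sum_nat_eq0 => /forallPn[i /= mi].
  apply/hasP; exists U_(i)%MM; first by apply/map_f; rewrite mem_enum.
  apply/mnm_lepP => j; rewrite mnm1E; case: eqP => //= <-.
  by rewrite lt0n.
exists (fun i => g i); split; last by move=> i m; rewrite -nthE; exact: gf.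
rewrite fg; move: (g) => g'; rewrite sz; apply: eq_bigr => i _.
by rewrite nthE.
Qed.

End PowerSeriesCoefficients.

(** * Evaluation of power series in a complete algebra *)

Section LiftPowerSeries.
Variables (K : fieldType) (n : nat) (B : augAlg K) (b : 'I_n -> B).
Local Notation m := (@aug_ideal K B).
Hypotheses (cB : adically_complete m) (mb : forall i, m (b i)).
Implicit Types (f g : fps K n) (p : {mpoly K[n]}).
Let idm := @aug_ideal_is_ideal K B.
Let ev p : B := mmap (in_alg B) b p.

Let mmap1_exp u : ideal_exp m (mdeg u) (mmap1 b u).
Proof.
rewrite mdegE /mmap1; elim/big_rec2: _ => // i x k _ IH.
by apply: ideal_exp_addn => //; apply: ideal_expX.
Qed.

Lemma mmap_ideal_exp k p : (forall u, (mdeg u < k)%N -> p@_u = 0) -> ideal_exp m k (ev p).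
Proof.
move=> p0; rewrite /ev /mmap; apply: is_ideal_sum => [|u _]; first exact: ideal_exp_is_ideal.
case: (ltnP (mdeg u) k) => [/p0->|ku].
  rewrite raddf0 mul0r; by case: (ideal_exp_is_ideal k idm).
case: (ideal_exp_is_ideal k idm) => _ _; apply.
exact: ideal_expW ku (mmap1_exp u).
Qed.

Let evB p q : ev (p - q) = ev p - ev q.
Proof. exact: mmapB. Qed.

(** Consecutive truncations differ only in degree [k], so their values form a Cauchy sequence. *)
Let lift_ex f : exists x, forall k, ideal_exp m k (x - ev (fps_trunc k f)).
Proof.
case: cB => _; apply=> k; rewrite -evB; apply: mmap_ideal_exp => u uk.
by rewrite mcoeffB !mcoeff_trunc ?subrr // ltnW.
Qed.

Definition fps_lift f : B := sval (cid (lift_ex f)).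

(** Any polynomial agreeing with [f] below degree [k] computes the limit modulo m^k. The ring laws
    for [fps_lift] are checked against such polynomials and follow by separatedness. *)
Lemma fps_lift_mod k f p : (forall u, (mdeg u < k)%N -> p@_u = f u) ->
  ideal_exp m k (fps_lift f - ev p).
Proof.
move=> pf; have [_ mD _] := ideal_exp_is_ideal k idm.
have -> : fps_lift f - ev p = (fps_lift f - ev (fps_trunc k f)) + ev (fps_trunc k f - p).
  by rewrite evB addrA subrK.
apply: (mD); first exact: (svalP (cid (lift_ex f))).
by apply: mmap_ideal_exp => u uk; rewrite mcoeffB mcoeff_trunc // pf // subrr.
Qed.

Lemma fps_lift_mpoly f p : (forall u, p@_u = f u) -> fps_lift f = mmap (in_alg B) b p.
Proof. by move=> pf; apply: (adic_separated cB) => k; apply: fps_lift_mod. Qed.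

Lemma fps_liftB : zmod_morphism fps_lift.
Proof.
move=> f g; apply: (adic_separated cB) => k; have idk := ideal_exp_is_ideal k idm.
have -> : fps_lift (f - g) - (fps_lift f - fps_lift g) =
    (fps_lift (f - g) - ev (fps_trunc k f - fps_trunc k g)) +
    - (fps_lift f - ev (fps_trunc k f)) + (fps_lift g - ev (fps_trunc k g)).
  rewrite evB; ring.
have tr h u (uk : (mdeg u < k)%N) : (fps_trunc k h)@_u = h u by exact: mcoeff_trunc.
have [_ mD _] := idk; apply: (mD); [apply: (mD)|].
- by apply: fps_lift_mod => u uk; rewrite mcoeffB !tr.
- by apply: is_idealN => //; apply: fps_lift_mod; apply: tr.
- by apply: fps_lift_mod; apply: tr.
Qed.

Lemma fps_liftM : monoid_morphism fps_lift.
Proof.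
split=> [|f g].
  rewrite (@fps_lift_mpoly _ 1) ?rmorph1 // => u; by rewrite mcoeff1 fps_1E.
apply: (adic_separated cB) => k; have [_ mD mM] := ideal_exp_is_ideal k idm.
set p := fps_trunc k f; set q := fps_trunc k g.
have tr h u (uk : (mdeg u < k)%N) : (fps_trunc k h)@_u = h u by exact: mcoeff_trunc.
have -> : fps_lift (f * g) - fps_lift f * fps_lift g =
    (fps_lift (f * g) - ev (p * q)) +
    - (fps_lift g * (fps_lift f - ev p) + ev p * (fps_lift g - ev q)).
  have -> : ev (p * q) = ev p * ev q by rewrite /ev rmorphM.
  ring.
apply: (mD); first by apply: fps_lift_mod; apply: fps_mul_mpoly; apply: tr.
apply: is_idealN; first exact: ideal_exp_is_ideal.
by apply: (mD); apply: (mM); apply: fps_lift_mod; apply: tr.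
Qed.

Lemma fps_lift_alg (a : K) : fps_lift a%:A = a%:A.
Proof.
rewrite (@fps_lift_mpoly _ a%:MP) ?mmapC // => u; rewrite mcoeffC.
by rewrite fps_scaleE fps_1E eq_sym.
Qed.

Lemma fps_liftZ : scalable fps_lift.
Proof.
move=> a f; rewrite -[f in LHS]mul1r scalerAl (fps_liftM).2 fps_lift_alg.
by rewrite -scalerAl mul1r.
Qed.

Lemma fps_lift_var i : fps_lift (fps_var K i) = b i.
Proof.
rewrite (@fps_lift_mpoly _ 'X_i) ?mmapX ?mmap1U // => u.
by rewrite mcoeffX eq_sym.
Qed.

(** This is the case k = 1: below degree 1 the series agrees with its constant term, and the first
    power of m is killed by the augmentation. *)
Lemma aug_fps_lift f : aug B (fps_lift f) = fps_eval0 f.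
Proof.
have idm1 := ideal_exp_is_ideal 1 idm.
have : ideal_exp m 1 (fps_lift f - ev (f 0%MM)%:MP).
  apply: fps_lift_mod => u; rewrite ltnS leqn0 mdeg_eq0 => /eqP->.
  by rewrite mcoeffC eqxx mulr1.
rewrite /ev mmapC -/(in_alg B (f 0%MM)) => -[s [sm E]].
have : m (fps_lift f - (f 0%MM)%:A).
  rewrite [X in m X]E big_seq; apply: is_ideal_sum => // u /sm[mu _].
  by rewrite mulrC; case: idm => _ _; apply.
rewrite /aug_ideal /= raddfB /= linearZZ rmorph1 => /eqP; rewrite subr_eq0 => /eqP->.
exact: mulr1.
Qed.

End LiftPowerSeries.

(** * The base *)

Lemma mem_gen_ideal (A : comNzRingType) (s : seq A) x : x \in s -> x \in gen_ideal s.
Proof.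
move=> xs; apply/asboolP; have si : (index x s < size s)%N by rewrite index_mem.
exists (fun i => (i == Ordinal si)%:R); rewrite (bigD1 (Ordinal si)) //= eqxx mul1r.
by rewrite nth_index // big1 ?addr0 // => i /negPf->; rewrite mul0r.
Qed.

(** One inclusion between the ideal of the nine relations and the monomial ideal; [base_idealP]
    supplies the other. *)
Lemma relations_span (A : comNzRingType) (x y z w r : A) : r \in relations x y z w ->
  exists c1 c2 c3 c4, r = c1 * (x * z) + c2 * (x * w) + c3 * (y * z) + c4 * (y * w).
Proof.
rewrite !inE; do ![case/orP]; move=> /eqP->.
- exists 0, 1, (-1), 0; ring.
- exists (2%:R * z), (-1), 0, 0; ring.
- exists 1, 0, 0, 0; ring.
- exists (2%:R * (w - z ^+2)), 0, z, (-1); ring.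
- exists (-1), 1, 0, 0; ring.
- exists 0, 1, 0, 0; ring.
- exists 1, 0, 0, 0; ring.
- exists w, 0, 0, 0; ring.
- exists (- 2%:R * z), 1, 1, 0; ring.
Qed.

Section BaseIdeal.
Variable K : fieldType.
Local Notation S := (fps K 4).
Local Notation t i := (fps_var K (i : 'I_4)).
Local Notation B := (base K).
Local Notation m := (@aug_ideal K B).
Implicit Types (f g : S) (u v : 'X_{1..4}).

(* The monomials that survive in the base: those in t_1, t_2 only or in t_3, t_4
   only. *)
Definition pure u := (u 0%R == 0%N) && (u 1%R == 0%N) || (u 2%:R == 0%N) && (u 3%:R == 0%N).

Definition mixed_gens : seq 'X_{1..4} :=
  [:: (U_(0%R) + U_(2%:R))%MM; (U_(0%R) + U_(3%:R))%MM;
      (U_(1%R) + U_(2%:R))%MM; (U_(1%R) + U_(3%:R))%MM].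

Lemma pureN u : ~~ pure u = has (fun v => (v <= u)%MM) mixed_gens.
Proof.
have le2 (i j : 'I_4) : i != j -> (U_(i) + U_(j) <= u)%MM = (u i != 0%N) && (u j != 0%N).
  move=> ij; apply/mnm_lepP/andP => [le|[ui uj] k].
    split; [move: (le i)|move: (le j)]; rewrite mnmDE !mnm1E eqxx.
      by rewrite eq_sym (negPf ij) addn0 lt0n.
    by rewrite (negPf ij) add0n lt0n.
  rewrite mnmDE !mnm1E; case: eqP => [<-|_]; last by case: eqP => // <-; rewrite lt0n.
  by rewrite eq_sym (negPf ij) lt0n.
rewrite /mixed_gens /= !le2 // /pure.
by do 4?case: (u _ == _).
Qed.

Lemma pureD u v : pure (u + v)%MM -> pure u /\ pure v.
Proof.
rewrite /pure !mnmDE !addn_eq0 => /orP[] /andP[/andP[-> ->] /andP[-> ->]];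
by rewrite ?orbT.
Qed.

Definition mixed f := forall u, pure u -> f u = 0.

Lemma mixedD f g : mixed f -> mixed g -> mixed (f + g).
Proof. by move=> f0 g0 u pu; rewrite [LHS](_ : _ = f u + g u) // f0 // g0 // addr0. Qed.

Lemma mixedM f g : mixed g -> mixed (f * g).
Proof.
move=> g0 u pu; rewrite fps_mulE big1 // => k /eqP uE.
by rewrite g0 ?mulr0 //; case: (@pureD k.1 k.2); rewrite -?uE.
Qed.

Lemma mixed_var (i j : 'I_4) : (U_(i) + U_(j))%MM \in mixed_gens -> mixed (t i * t j).
Proof.
move=> ij u pu; rewrite -[fps_var K i]/(fps_mono K U_(i)%MM) -[fps_var K j]/(fps_mono K U_(j)%MM).
rewrite fps_monoM /fps_mono; case: eqP => // uE; suff : ~~ pure u by rewrite pu.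
rewrite pureN.
by apply/hasP; exists u; rewrite ?uE ?lepm_refl.
Qed.

(** The relations generate exactly the ideal of the four monomials in [mixed_gens], so membership is
    tested coefficient by coefficient. *)
Lemma base_idealP f : reflect (mixed f) (f \in @base_ideal K).
Proof.
have t02 : mixed (t 0 * t 2%:R) by apply: mixed_var; rewrite !inE eqxx ?orbT.
have t03 : mixed (t 0 * t 3%:R) by apply: mixed_var; rewrite !inE eqxx ?orbT.
have t12 : mixed (t 1 * t 2%:R) by apply: mixed_var; rewrite !inE eqxx ?orbT.
have t13 : mixed (t 1 * t 3%:R) by apply: mixed_var; rewrite !inE eqxx ?orbT.
apply: (iffP idP) => [/asboolP[c ->]|f0].
  apply: big_ind; [|exact: mixedD|].
    by move=> u _; rewrite /GRing.zero /= /fps_const if_same.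
  move=> i _; apply: mixedM.
  have [|c1 [c2 [c3 [c4 ->]]]] := @relations_span _ (t 0) (t 1) (t 2%:R) (t 3%:R)
    (relations (t 0) (t 1) (t 2%:R) (t 3%:R))`_i; first by apply: mem_nth; case: i.
  by repeat apply: mixedD; apply: mixedM.
have [idl0 _ idlD] := base_ideal_idealr K.
have [|g [-> _]] := @fps_mono_span K 4 mixed_gens f.
  by move=> u fu; rewrite -pureN; apply: contraNN fu => /f0->.
have rI h : h \in relations (t 0) (t 1) (t 2%:R) (t 3%:R) -> h \in @base_ideal K.
  exact: mem_gen_ideal.
have idD x y : x \in @base_ideal K -> y \in @base_ideal K -> x + y \in @base_ideal K.
  by move=> xI yI; rewrite -[x]mul1r; apply: idlD.
have idM x y : y \in @base_ideal K -> x * y \in @base_ideal K.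
  by move=> yI; rewrite -[_ * _]addr0; apply: idlD.
have m02 : t 0 * t 2%:R \in @base_ideal K by apply: rI; rewrite !inE eqxx ?orbT.
have m03 : t 0 * t 3%:R \in @base_ideal K by apply: rI; rewrite !inE eqxx ?orbT.
(* t_2 t_3 is t_1 t_4 minus the first relation. *)
have m12 : t 1 * t 2%:R \in @base_ideal K.
  have -> : t 1 * t 2%:R = t 0 * t 3%:R + (-1) * (t 0 * t 3%:R - t 1 * t 2%:R) by ring.
  by apply: (idD) => //; apply: (idM); apply: rI; rewrite !inE eqxx.
(* Expanding the fourth relation expresses t_2 t_4 through that relation, t_1 t_3 and t_2 t_3. *)
have m13 : t 1 * t 3%:R \in @base_ideal K.
  have -> : t 1 * t 3%:R = (2%:R * (t 3%:R - t 2%:R ^+ 2)) * (t 0 * t 2%:R) +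
     (t 2%:R * (t 1 * t 2%:R) + (-1) * ((2%:R * t 0 * t 2%:R - t 1) * (t 3%:R - t 2%:R ^+ 2))).
    ring.
  apply: (idD); first exact: idM.
  by apply: (idD); apply: (idM) => //; apply: rI; rewrite !inE eqxx ?orbT.
rewrite /= !big_ord_recl big_ord0 addr0 /= -!fps_monoM.
by repeat apply: (idD); rewrite mulrC; apply: (idM).
Qed.

Lemma base_pi_eq f g : base_pi f = base_pi g <-> mixed (f - g).
Proof.
rewrite (rwP (base_idealP _)) Quotient.idealrBE.
by split=> [/eqP|/eqP].
Qed.

Lemma base_pi_zmod : zmod_morphism (@base_pi K).
Proof. by move=> f g; rewrite -base_piB. Qed.
Lemma base_pi_monoid : monoid_morphism (@base_pi K).
Proof. by split=> [|f g]; rewrite ?base_pi1 ?base_piM. Qed.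
Lemma base_pi_scalable : scalable (@base_pi K).
Proof. by move=> a f; rewrite -base_piZ. Qed.
HB.instance Definition _ := GRing.isZmodMorphism.Build S (base_alg K) (@base_pi K) base_pi_zmod.
HB.instance Definition _ := GRing.isMonoidMorphism.Build S (base_alg K) (@base_pi K) base_pi_monoid.
HB.instance Definition _ := GRing.isScalable.Build K S (base_alg K) *:%R (@base_pi K)
  base_pi_scalable.

Let idm := @aug_ideal_is_ideal K B.

Lemma aug_base_pi f : aug B (base_pi f) = f 0%MM.
Proof. exact: base_aug_pi. Qed.

Lemma aug_base_var i : aug_ideal (base_pi (t i) : B).
Proof.
rewrite /aug_ideal /= aug_base_pi /fps_var; case: eqP => // /(congr1 (@mdeg _)).
by rewrite mdeg0 mdeg1.
Qed.

Lemma base_pi_exp k f : (forall u, (mdeg u < k)%N -> f u = 0) -> ideal_exp m k (base_pi f).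
Proof.
elim: k f => // k IHk f f0.
have [|g [fg gf]] := @fps_gen_span K 4 f; first by rewrite f0 ?mdeg0.
rewrite fg raddf_sum /=; apply: (@is_ideal_sum _ (ideal_exp m k.+1)) => [|i _].
  exact: (ideal_exp_is_ideal k.+1 idm).
rewrite -base_piM; apply: ideal_expM; first exact: aug_base_var.
apply: IHk => u uk; have [->//|->] := gf i u.
by rewrite f0 // mdegD mdeg1 addn1 ltnS.
Qed.

(** The m-adic filtration becomes the degree filtration on pure coefficients, which turns
    completeness into a statement about single coefficients. *)
Lemma ideal_exp_base_piP k f :
  ideal_exp m k (base_pi f) <-> (forall u, pure u -> (mdeg u < k)%N -> f u = 0).
Proof.
split=> [|f0].
  elim: k f => [|k IHk] f; first by [].
  move=> [s [sm fE]] u pu uk.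
  have [F FE] : exists F : seq (S * S), s = [seq (base_pi w.1, base_pi w.2) | w <- F].
    elim: (s) => [|[x y] s' [F ->]]; first by exists [::].
    have [f1 ->] := base_piP x; have [f2 ->] := base_piP y.
    by exists ((f1, f2) :: F).
  have : mixed (f - \sum_(w <- F) w.1 * w.2).
    apply/base_pi_eq; rewrite fE FE big_map raddf_sum /=.
    by apply: eq_bigr => w _; rewrite -base_piM.
  move/(_ u pu); rewrite fps_subE => /eqP; rewrite subr_eq0 => /eqP->.
  rewrite fps_sumE big_seq big1 // => w wF.
  have [] : m (base_pi w.1) /\ ideal_exp m k (base_pi w.2).
    by apply: (sm (base_pi w.1, base_pi w.2)); rewrite FE; apply: map_f wF.
  rewrite /aug_ideal /= base_aug_pi /fps_eval0 => v10 /IHk v2k.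
  rewrite fps_mulE big1 // => -[k1 k2] /= /eqP uE.
  have [|_ pk2] := @pureD k1 k2; first by rewrite -uE.
  (* The first factor has no constant term, so it takes at least one degree away from [u] and leaves
     degree below [k] for the second. *)
  have [k10|k10] := eqVneq (k1 : 'X_{1..4}) 0%MM; first by rewrite k10 v10 mul0r.
  rewrite v2k ?mulr0 //; have := uk; rewrite [X in (mdeg X < _)%N -> _]uE mdegD ltnS.
  by apply: leq_trans; rewrite -add1n leq_add2r lt0n mdeg_eq0.
(* Dropping the mixed coefficients does not change the class in the base. *)
pose g : S := fun u => if pure u then f u else 0.
have -> : base_pi f = base_pi g.
  by apply/base_pi_eq => u pu; rewrite fps_subE /g pu subrr.
by apply: base_pi_exp => u uk; rewrite /g; case: ifP => // pu; apply: f0.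
Qed.

Lemma base_complete : adically_complete m.
Proof.
split=> [x x0|a ac].
  have [f xE] := base_piP x; rewrite xE in x0 *.
  rewrite -[0](raddf0 (@base_pi K)); apply/base_pi_eq => u pu; rewrite subr0.
  by have /ideal_exp_base_piP := x0 (mdeg u).+1; apply.
have [F FE] : exists F : nat -> S, forall k, a k = base_pi (F k).
  have /choice[F FE] : forall k, exists f : S, a k = base_pi f by move=> k; exact: base_piP.
  by exists F.
have stepF k u : pure u -> (mdeg u < k)%N -> F k.+1 u = F k u.
  move=> pu uk; apply/eqP; rewrite -subr_eq0 -fps_subE; apply/eqP.
  by have := ac k; rewrite !FE base_piB => /ideal_exp_base_piP; apply.
(* By [stepF] the coefficient at a pure [u] is constant from index [(mdeg u).+1] on, and the limit
   takes that value. *)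
exists (base_pi (fun u => F (mdeg u).+1 u)) => k.
rewrite FE base_piB; apply/ideal_exp_base_piP => u pu uk; rewrite fps_subE.
suff -> : F k u = F (mdeg u).+1 u by rewrite subrr.
rewrite -(subnK uk); elim: (k - _)%N => // n IHn.
by rewrite addSn stepF // leq_addl.
Qed.

End BaseIdeal.

(** Bundles functions whose morphism laws depend on hypotheses of the context, such as [fps_lift]
    and the map it induces on the quotient. *)
Lemma fun_lrmorphism (K : nzRingType) (A B : comAlgType K) (F : A -> B) :
  zmod_morphism F -> monoid_morphism F -> scalable F ->
  exists f : {lrmorphism A -> B}, f =1 F.
Proof.
move=> Fz Fm Fs.
pose G := HB.pack F (GRing.isZmodMorphism.Build A B F Fz)
  (GRing.isMonoidMorphism.Build A B F Fm)
  (GRing.isScalable.Build K A B *:%R F Fs) : {lrmorphism A -> B}.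
by exists G.
Qed.

(** * Morphisms out of the base *)

Section BaseMorphisms.
Variables (K : fieldType) (B : augAlg K).
Local Notation t i := (base_pi (fps_var K (i : 'I_4))).

(** Evaluation at [b] sends each relation in the variables to the same relation in the [b i], so it
    kills the ideal and descends to the quotient. *)
Lemma base_lift (b : 'I_4 -> B) : adically_complete (@aug_ideal K B) ->
    (forall i, aug_ideal (b i)) ->
    (forall r, r \in relations (b 0) (b 1) (b 2%:R) (b 3%:R) -> r = 0) ->
  exists f : {lrmorphism base K -> B}, aug_morphism f /\ forall i, f (t i) = b i.
Proof.
move=> cB mb rb; pose L := fps_lift cB mb.
have LZ : zmod_morphism L := fps_liftB cB mb.
have LM : monoid_morphism L := fps_liftM cB mb.
have [l lE] := fun_lrmorphism LZ LM (fps_liftZ cB mb).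
have l0 f : f \in @base_ideal K -> l f = 0.
  move=> /asboolP[c ->]; rewrite raddf_sum big1 // => i _ /=.
  rewrite rmorphM [X in _ * X](_ : _ = 0) ?mulr0 //.
  transitivity (relations (b 0) (b 1) (b 2%:R) (b 3%:R))`_i; last first.
    by apply: rb; apply: mem_nth; case: i.
  rewrite -!(fps_lift_var cB mb) -!/(L _) -!lE.
  case: i => i /= _; do 9?[case: i => [|i] /=];
  by rewrite ?nth_nil ?raddf0 // ?(rmorph_nat, rmorphXn, rmorphB, rmorphD, rmorphM).
(* The induced map is computed on chosen representatives; [l0] makes the choice irrelevant. *)
pose F (x : base_alg K) : B := l (repr (x : {ideal_quot @base_ideal K})).
have Fpi f : F (base_pi f) = l f.
  apply/eqP; rewrite -subr_eq0 -rmorphB; apply/eqP/l0.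
  by rewrite Quotient.idealrBE reprK.
have [||| g gE] := @fun_lrmorphism K (base_alg K) B F.
- move=> x y; have [f ->] := base_piP x; have [h ->] := base_piP y.
  by rewrite base_piB !Fpi rmorphB.
- split=> [|x y]; first by rewrite -base_pi1 Fpi rmorph1.
  have [f ->] := base_piP x; have [h ->] := base_piP y.
  by rewrite base_piM !Fpi rmorphM.
- move=> c x; have [f ->] := base_piP x.
  by rewrite base_piZ !Fpi linearZ.
exists g; split=> [x|i]; last by rewrite gE Fpi lE /L fps_lift_var.
have [f ->] := base_piP x.
by rewrite gE Fpi lE /L aug_fps_lift aug_base_pi.
Qed.

(* A morphism is not assumed continuous, but into an infinitesimal algebra it kills the
   square of the maximal ideal. *)
Lemma base_morphism_ext (f f' : {lrmorphism base K -> B}) : infinitesimal B ->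
    aug_morphism f -> aug_morphism f' ->
    (forall i, f (t i) = f' (t i)) -> f =1 f'.
Proof.
move=> iB af af' eqt x; have [h ->] := base_piP x.
have [|g [hE _]] := @fps_gen_span K 4 (h - (h 0%MM)%:A).
  by rewrite fps_subE fps_scaleE fps_1E eqxx mulr1 subrr.
have lC (l : {lrmorphism base K -> B}) a : l (base_pi a%:A) = a%:A.
  by rewrite -base_piZ base_pi1 linearZ /= (rmorph1 l).
have val (l : {lrmorphism base K -> B}) : aug_morphism l ->
    l (base_pi h) = (h 0%MM)%:A + \sum_i (g i 0%MM) *: l (t i).
  move=> al; rewrite -{1}[h](subrK (h 0%MM)%:A) hE addrC.
  rewrite !raddfD /= lC; congr (_ + _).
  rewrite !raddf_sum /=; apply: eq_bigr => i _; rewrite -base_piM rmorphM.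
  have [r rE gE] : exists2 r : fps K 4, r 0%MM = 0 & g i = (g i 0%MM)%:A + r.
    exists (g i - (g i 0%MM)%:A); last by rewrite addrC subrK.
    by rewrite fps_subE fps_scaleE fps_1E eqxx mulr1 subrr.
  rewrite (congr1 (@base_pi K) gE) !raddfD /= lC mulrDr -scalerAr mulr1 iB ?addr0 //.
    by rewrite /aug_ideal /= [LHS](al (t i)); exact: aug_base_var.
  by rewrite /aug_ideal /= [LHS](al (base_pi r)) aug_base_pi.
by rewrite !val //; congr (_ + _); apply: eq_bigr => i _; rewrite eqt.
Qed.

End BaseMorphisms.

(** * Codifferentials *)

Local Notation v1 := (@Ordinal 3 0 isT).
Local Notation v2 := (@Ordinal 3 1 isT).
Local Notation v3 := (@Ordinal 3 2 isT).

Lemma sum_ord3 (V : nmodType) (F : 'I_3 -> V) : \sum_i F i = F v1 + F v2 + F v3.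
Proof.
rewrite !big_ord_recl big_ord0 addr0 addrA.
by congr (F _ + F _ + F _); apply/val_inj.
Qed.

Lemma ord3_ind (P : 'I_3 -> Prop) : P v1 -> P v2 -> P v3 -> forall i, P i.
Proof.
move=> P1 P2 P3 [[|[|[|//]]] i3].
- by rewrite (_ : Ordinal i3 = v1) //; apply/val_inj.
- by rewrite (_ : Ordinal i3 = v2) //; apply/val_inj.
- by rewrite (_ : Ordinal i3 = v3) //; apply/val_inj.
Qed.

Section Codifferentials.
Variable A : comNzRingType.
Implicit Types (d : cochain A) (g : 'M[A]_3) (x y z : 'rV[A]_3).
Local Notation e i := (delta_mx 0 i : 'rV[A]_3).

Lemma extE d x y k : ext d x y 0 k = \sum_i \sum_j x 0 i * y 0 j * d (i, j) 0 k.
Proof.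
rewrite /ext summxE; apply: eq_bigr => i _; rewrite summxE; apply: eq_bigr => j _.
by rewrite mxE.
Qed.

Lemma ext_suml d (I : Type) (r : seq I) (c : I -> A) (X : I -> 'rV[A]_3) y :
  ext d (\sum_(i <- r) c i *: X i) y = \sum_(i <- r) c i *: ext d (X i) y.
Proof.
apply/rowP => k; rewrite extE summxE.
under eq_bigr => a _ do under eq_bigr => b _ do
  rewrite summxE mulr_suml mulr_suml.
under eq_bigr => a _ do rewrite exchange_big.
rewrite exchange_big; apply: eq_bigr => i _ /=; rewrite mxE extE mulr_sumr.
by apply: eq_bigr => a _; rewrite mulr_sumr; apply: eq_bigr => b _; rewrite mxE -!mulrA.
Qed.

Lemma ext_sumr d (I : Type) (r : seq I) (c : I -> A) x (Y : I -> 'rV[A]_3) :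
  ext d x (\sum_(i <- r) c i *: Y i) = \sum_(i <- r) c i *: ext d x (Y i).
Proof.
apply/rowP => k; rewrite extE summxE.
under eq_bigr => a _ do under eq_bigr => b _ do
  rewrite summxE mulr_sumr mulr_suml.
under eq_bigr => a _ do rewrite exchange_big.
rewrite exchange_big; apply: eq_bigr => i _ /=; rewrite mxE extE mulr_sumr.
apply: eq_bigr => a _; rewrite mulr_sumr; apply: eq_bigr => b _; rewrite mxE.
by rewrite -!mulrA mulrCA.
Qed.

Lemma ext_delta d i j : ext d (e i) (e j) = d (i, j).
Proof.
rewrite /ext (bigD1 i) //= (bigD1 j) //= !mxE !eqxx mul1r scale1r.
rewrite big1 ?addr0 => [|k kj]; last by rewrite !mxE !eqxx (negPf kj) mulr0 scale0r.
rewrite big1 ?addr0 // => l li; rewrite big1 // => k _.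
by rewrite !mxE eqxx (negPf li) mul0r scale0r.
Qed.

Lemma ext_rows d (g : 'M[A]_3) x y :
  ext d (x *m g) (y *m g) = \sum_i \sum_j (x 0 i * y 0 j) *: ext d (row i g) (row j g).
Proof.
rewrite !mulmx_sum_row ext_suml; apply: eq_bigr => i _.
by rewrite ext_sumr scaler_sumr; apply: eq_bigr => j _; rewrite scalerA.
Qed.

(** Multiplying by [g] on the right clears the inverse, and bilinearity reduces the rest to basis
    vectors. *)
Lemma transports_basis g g' d d' : g *m g' = 1%:M -> g' *m g = 1%:M ->
  (forall i j, d' (i, j) *m g = ext d (row i g) (row j g)) -> transports g g' d d'.
Proof.
move=> gg' g'g E; split=> // x y.
rewrite ext_rows [LHS]/ext mulmx_suml; apply: eq_bigr => i _.
rewrite mulmx_suml; apply: eq_bigr => j _; rewrite -scalemxAl -E.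
by rewrite -mulmxA gg' mulmx1.
Qed.

Lemma transportsE g g' d d' i j : transports g g' d d' ->
  d' (i, j) *m g = ext d (row i g) (row j g).
Proof. by move=> [_ g'g E]; rewrite -ext_delta E -mulmxA g'g mulmx1 !rowE. Qed.

Lemma transports_sym g g' d d' : transports g g' d d' -> transports g' g d' d.
Proof.
move=> [gg' g'g E]; split=> // x y.
by rewrite E -!mulmxA g'g !mulmx1.
Qed.

Lemma homogeneous_delta i : homogeneous (parity i) (e i).
Proof. by move=> j ji; rewrite mxE eqxx /=; case: (j =P i) ji => [->|//]; rewrite eqxx. Qed.

Lemma odd_cochainP d : odd_cochain d <->
  forall i j k, parity k == parity i (+) parity j -> d (i, j) 0 k = 0.
Proof.
split=> [od i j k kij|d0 p q x y hx hy k kpq].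
  rewrite -ext_delta; apply: (od _ _ _ _ (@homogeneous_delta i) (@homogeneous_delta j)).
  by rewrite (eqP kij); case: (_ (+) _).
rewrite extE big1 // => i _; rewrite big1 // => j _.
case: (eqVneq (parity i) p) => [ip|/hx->]; last by rewrite !mul0r.
case: (eqVneq (parity j) q) => [jq|/hy->]; last by rewrite mulr0 mul0r.
rewrite d0 ?mulr0 // ip jq; by case: (parity k) (_ (+) _) kpq => -[].
Qed.

Lemma codifferentialP d : codifferential d <-> odd_cochain d /\
  forall i j k, ext d (d (i, j)) (e k) + (-1) ^+ parity i *: ext d (e i) (d (j, k)) = 0.
Proof.
split=> [[od cd]|[od cd]]; split=> //.
  move=> i j k; rewrite -2!ext_delta.
  by apply: cd; apply: homogeneous_delta.
move=> p q r x y z hx _ _.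
have -> : ext d (ext d x y) z =
    \sum_i \sum_j \sum_k (x 0 i * y 0 j * z 0 k) *: ext d (d (i, j)) (e k).
  rewrite {2}/ext pair_bigA ext_suml.
  rewrite -(pair_bigA _ (fun i j => (x 0 i * y 0 j) *: ext d (d (i, j)) z)) /=.
  apply: eq_bigr => i _; apply: eq_bigr => j _.
  rewrite {1}[z]matrix_sum_delta big_ord1 ext_sumr scaler_sumr.
  by apply: eq_bigr => k _; rewrite scalerA.
have -> : ext d x (ext d y z) =
    \sum_i \sum_j \sum_k (x 0 i * y 0 j * z 0 k) *: ext d (e i) (d (j, k)).
  rewrite {1}[x]matrix_sum_delta big_ord1 ext_suml; apply: eq_bigr => i _.
  rewrite {2}/ext pair_bigA ext_sumr.
  rewrite -(pair_bigA _ (fun j k => (y 0 j * z 0 k) *: ext d (e i) (d (j, k)))) /=.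
  rewrite scaler_sumr; apply: eq_bigr => j _; rewrite scaler_sumr; apply: eq_bigr => k _.
  by rewrite scalerA mulrA.
rewrite scaler_sumr -big_split big1 // => i _ /=.
(* Coordinates of [x] of the wrong parity vanish; for the others the sign is the one attached to the
   basis vector. *)
case: (eqVneq (parity i) p) => [<-|/hx x0]; last first.
  by rewrite !big1 ?scaler0 ?addr0 // => j _; rewrite big1 // => k _; rewrite x0 !mul0r scale0r.
rewrite scaler_sumr -big_split big1 // => j _ /=.
rewrite scaler_sumr -big_split big1 // => k _ /=.
by rewrite scalerA [(-1) ^+ _ * _]mulrC -[(_ * (-1) ^+ _) *: _]scalerA -scalerDr cd scaler0.
Qed.

Lemma codifferential_componentsP d : codifferential d <-> odd_cochain d /\
  forall i j k l, \sum_a d (i, j) 0 a * d (a, k) 0 l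
    + (-1) ^+ parity i * \sum_a d (j, k) 0 a * d (i, a) 0 l = 0.
Proof.
have comp i j k l : \sum_a d (i, j) 0 a * d (a, k) 0 l
    + (-1) ^+ parity i * \sum_a d (j, k) 0 a * d (i, a) 0 l =
    (ext d (d (i, j)) (e k) + (-1) ^+ parity i *: ext d (e i) (d (j, k))) 0 l.
  rewrite !mxE; congr (_ + _ * _).
    rewrite extE; apply: eq_bigr => a _; rewrite [RHS](bigD1 k) //= mxE !eqxx mulr1 big1 ?addr0 //.
    by move=> b bk; rewrite mxE (negPf bk) mulr0 mul0r.
  rewrite extE [RHS](bigD1 i) //= [X in _ + X]big1 ?addr0 => [|b bi]; last first.
    by rewrite big1 // => a _; rewrite mxE (negPf bi) mul0r mul0r.
  by apply: eq_bigr => a _; rewrite mxE !eqxx mul1r.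
rewrite codifferentialP; split=> -[od E]; split=> //.
  by move=> i j k l; rewrite comp E mxE.
by move=> i j k; apply/rowP => l; rewrite -comp E mxE.
Qed.

Lemma codifferential_transports g g' d d' : transports g g' d d' ->
  even_mx g -> even_mx g' -> codifferential d -> codifferential d'.
Proof.
move=> [gg' g'g E] eg eg' [od cd]; split=> [p q x y hx hy|p q r x y z hx hy hz].
  by rewrite E; apply: eg'; apply: od; apply: eg.
(* Between the two applications of [d] the factor [g' *m g] cancels, leaving the identity for
   [d]. *)
rewrite !E -!(mulmxA _ g' g) g'g !mulmx1 scalemxAl -mulmxDl.
by rewrite (cd p q r) ?mul0mx //; apply: eg.
Qed.

Lemma even_mxP g : (forall i j, parity i != parity j -> g i j = 0) -> even_mx g.
Proof.
move=> g0 p x hx j jp; rewrite mxE big1 // => i _.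
case: (eqVneq (parity i) p) => [ip|/hx->]; last by rewrite mul0r.
by rewrite g0 ?mulr0 // ip eq_sym.
Qed.

Lemma even_mxE g i j : even_mx g -> parity i != parity j -> g i j = 0.
Proof.
move=> eg ij; have := eg _ _ (@homogeneous_delta i) j.
by rewrite -rowE mxE; apply; rewrite eq_sym.
Qed.

End Codifferentials.

(** * Normal forms of codifferentials near psi^{22}_3 *)

Section NormalForm.
Variable A : comNzRingType.
Implicit Types (t : A) (d : cochain A).

(** The analogue of [base_idealP] for elements of an arbitrary ring: the first relation yields t_2
    t_3 = 0 once t_1 t_4 = 0, and the fourth then yields t_2 t_4 = 0. *)
Lemma relationsP t1 t2 t3 t4 : (forall r, r \in relations t1 t2 t3 t4 -> r = 0) <->
  [/\ t1 * t3 = 0, t1 * t4 = 0, t2 * t3 = 0 & t2 * t4 = 0].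
Proof.
split=> [r0|[h13 h14 h23 h24] r /relations_span[c1 [c2 [c3 [c4 ->]]]]]; last first.
  by rewrite h13 h14 h23 h24 !mulr0 !addr0.
have h13 : t1 * t3 = 0 by apply: r0; rewrite !inE eqxx ?orbT.
have h14 : t1 * t4 = 0 by apply: r0; rewrite !inE eqxx ?orbT.
have h23 : t2 * t3 = 0.
  transitivity (t1 * t4 - (t1 * t4 - t2 * t3)); first by ring.
  by rewrite (r0 (t1 * t4 - t2 * t3)) ?inE ?eqxx // h14 subr0.
split=> //; transitivity ((2%:R * t4 - 2%:R * t3 ^+ 2) * (t1 * t3) + t3 * (t2 * t3) -
  (2%:R * t1 * t3 - t2) * (t4 - t3 ^+ 2)); first by ring.
by rewrite (r0 (_ * (t4 - _))) ?inE ?eqxx ?orbT // h13 h23 !mulr0 !addr0 subr0.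
Qed.

(* What remains of dinf modulo the relations, as a table of coefficients; the indices are
   zero-based. *)
Definition normal_coef t1 t2 t3 t4 (i j k : nat) : A :=
  match i, j, k with
  | 0%N, 0%N, 2%N => t4 | 1%N, 0%N, 2%N => t3 | 1%N, 1%N, 2%N => 1
  | 2%N, 1%N, 0%N => t1 | 1%N, 2%N, 0%N => - t1
  | 2%N, 1%N, 1%N => t2 | 1%N, 2%N, 1%N => - t2 | 2%N, 2%N, 2%N => t2
  | _, _, _ => 0 end.

Definition normal_form t1 t2 t3 t4 : cochain A :=
  [ffun ij : 'I_3 * 'I_3 => \row_(k < 3) normal_coef t1 t2 t3 t4 ij.1 ij.2 k].

Lemma normal_formE t1 t2 t3 t4 i j k :
  normal_form t1 t2 t3 t4 (i, j) 0 k = normal_coef t1 t2 t3 t4 i j k.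
Proof. by rewrite ffunE mxE. Qed.

(** Every term of [dinf] absent from the table is a multiple of t_1 t_3, t_1 t_4 or t_2 t_3. *)
Lemma dinf_normal_form t1 t2 t3 t4 :
  t1 * t3 = 0 -> t1 * t4 = 0 -> t2 * t3 = 0 ->
  dinf t1 t2 t3 t4 = normal_form t1 t2 t3 t4.
Proof.
move=> h13 h14 h23; apply/ffunP => -[i j]; apply/rowP => k; rewrite normal_formE.
rewrite !(ffunE, mxE) -!(mulrA 2%:R) (mulrC _ t1) exprS !(mulrA t1) h13 h14 h23 !mul0r.
elim/ord3_ind: i; elim/ord3_ind: j; elim/ord3_ind: k => /=;
  by rewrite ?(mulr0, mulr1, mul0r, addr0, add0r, subr0, sub0r, oppr0).
Qed.

Lemma odd_normal_form t1 t2 t3 t4 : odd_cochain (normal_form t1 t2 t3 t4).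
Proof.
apply/odd_cochainP => i j k; rewrite normal_formE.
by elim/ord3_ind: i; elim/ord3_ind: j; elim/ord3_ind: k.
Qed.

Lemma codifferential_normal_form t1 t2 t3 t4 :
  t1 * t3 = 0 -> t1 * t4 = 0 -> t2 * t3 = 0 -> t2 * t4 = 0 ->
  codifferential (normal_form t1 t2 t3 t4).
Proof.
move=> h13 h14 h23 h24; apply/codifferential_componentsP; split; first exact: odd_normal_form.
(* Each vanishing product is listed in both orders, since rewriting does not see commutativity. *)
have rel := (h13, h14, h23, h24, etrans (mulrC _ _) h13, etrans (mulrC _ _) h14,
  etrans (mulrC _ _) h23, etrans (mulrC _ _) h24).
have simpl := (mulr0, mul0r, mulr1, mul1r, addr0, add0r, subr0, sub0r, mulrN, mulNr, oppr0).
move=> i j k l; rewrite !sum_ord3 !normal_formE.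
elim/ord3_ind: i; elim/ord3_ind: j; elim/ord3_ind: k; elim/ord3_ind: l => /=;
  rewrite ?simpl ?rel ?simpl //; ring.
Qed.

End NormalForm.

(** The coefficients of [dinf] are integer polynomials in its parameters. This serves for morphisms
    out of the base and for evaluating polynomial families at a point. *)
Lemma pushforward_dinf (A B : comNzRingType) (f : {rmorphism A -> B}) t1 t2 t3 t4 :
  [ffun ij => map_mx f (dinf t1 t2 t3 t4 ij)] = dinf (f t1) (f t2) (f t3) (f t4).
Proof.
apply/ffunP => ij; apply/rowP => k; rewrite !(ffunE, mxE).
by rewrite !(rmorph_nat, rmorphXn, rmorphB, rmorphN, rmorphD, rmorphM).
Qed.

(** * Even changes of basis and the reduction to normal form *)

Section EvenMatrices.
Variable A : comNzRingType.
Implicit Types (g : 'M[A]_3).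

(** The shape of any even endomorphism: the block with rows (a, b) and (c, d) on v_1, v_2, and the
    scalar [u] on v_3. *)
Definition even_block_coef (a b c d u : A) (i j : nat) : A :=
  match i, j with
  | 0%N, 0%N => a | 0%N, 1%N => b | 1%N, 0%N => c | 1%N, 1%N => d | 2%N, 2%N => u
  | _, _ => 0 end.

Definition even_block a b c d u : 'M[A]_3 := \matrix_(i < 3, j < 3) even_block_coef a b c d u i j.

Lemma even_even_block a b c d u : even_mx (even_block a b c d u).
Proof. by apply: even_mxP => i j; rewrite mxE; elim/ord3_ind: i; elim/ord3_ind: j. Qed.

Lemma mul_even_block a b c d u a' b' c' d' u' :
  even_block a b c d u *m even_block a' b' c' d' u' =
  even_block (a * a' + b * c') (a * b' + b * d') (c * a' + d * c') (c * b' + d * d') (u * u').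
Proof.
apply/matrixP => i j; rewrite mxE sum_ord3 !mxE.
by elim/ord3_ind: i; elim/ord3_ind: j => /=; rewrite ?(mulr0, mul0r, addr0, add0r).
Qed.

Lemma even_block1 : even_block 1 0 0 1 1 = 1%:M.
Proof. by apply/matrixP => i j; rewrite !mxE; elim/ord3_ind: i; elim/ord3_ind: j. Qed.

Lemma ext_rowE (d : cochain A) g i j k :
  ext d (row i g) (row j g) 0 k = \sum_a \sum_b g i a * g j b * d (a, b) 0 k.
Proof. by rewrite extE; apply: eq_bigr => a _; apply: eq_bigr => b _; rewrite !mxE. Qed.

Lemma transports_components g g' (d d' : cochain A) i j k : transports g g' d d' ->
  \sum_l d' (i, j) 0 l * g l k = \sum_a \sum_b g i a * g j b * d (a, b) 0 k.
Proof. by move=> /(transportsE i j)/rowP/(_ k); rewrite ext_rowE mxE. Qed.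

Lemma transports_from_components g g' (d d' : cochain A) : g *m g' = 1%:M -> g' *m g = 1%:M ->
  (forall i j k, \sum_l d' (i, j) 0 l * g l k = \sum_a \sum_b g i a * g j b * d (a, b) 0 k) ->
  transports g g' d d'.
Proof.
move=> gg' g'g E; apply: transports_basis => // i j; apply/rowP => k.
by rewrite ext_rowE mxE E.
Qed.

(** Since d(v_1, v_2) = 0 and d(v_2, v_2) = v_3, the codifferential identity at each of a few
    triples of basis vectors gives either a value of [d] or a relation. *)
Lemma normal_form_exhaustive (d : cochain A) : codifferential d ->
  d (v1, v2) 0 v3 = 0 -> d (v2, v2) 0 v3 = 1 ->
  let t1 := d (v3, v2) 0 v1 in let t2 := d (v3, v2) 0 v2 in
  let t3 := d (v2, v1) 0 v3 in let t4 := d (v1, v1) 0 v3 in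
  [/\ d = normal_form t1 t2 t3 t4, t1 * t3 = 0, t1 * t4 = 0, t2 * t3 = 0 & t2 * t4 = 0].
Proof.
move=> /codifferential_componentsP[/odd_cochainP od E] d12 d22 t1 t2 t3 t4.
have simpl := (mulr0, mul0r, mulr1, mul1r, addr0, add0r).
have d23 l : d (v2, v3) 0 l = - d (v3, v2) 0 l.
  have := E v2 v2 v2 l; rewrite !sum_ord3 ![d (v2, v2) 0 v1]od ?[d (v2, v2) 0 v2]od // d22 !simpl.
  by move/eqP; rewrite addrC addr_eq0 => /eqP.
have d13 l : d (v1, v3) 0 l = 0.
  have := E v1 v2 v2 l; rewrite !sum_ord3 ![d (v1, v2) 0 v1]od ?[d (v1, v2) 0 v2]od //.
  by rewrite ![d (v2, v2) 0 v1]od ?[d (v2, v2) 0 v2]od // d12 d22 expr0 !simpl.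
(* The triple (v_2, v_1, v_2) yields t_1 t_3 = t_2 t_3 = 0; likewise (v_1, v_1, v_2) yields the
   relations with t_4 in [t4d]. *)
have t3d l : t3 * d (v3, v2) 0 l = 0.
  have := E v2 v1 v2 l; rewrite !sum_ord3 ![d (v2, v1) 0 v1]od ?[d (v2, v1) 0 v2]od //.
  by rewrite ![d (v1, v2) 0 v1]od ?[d (v1, v2) 0 v2]od // d12 !simpl.
have d31 l : d (v3, v1) 0 l = 0.
  have := E v2 v2 v1 l; rewrite !sum_ord3 ![d (v2, v2) 0 v1]od ?[d (v2, v2) 0 v2]od //.
  rewrite ![d (v2, v1) 0 v1]od ?[d (v2, v1) 0 v2]od // d22 d23 -/t3 mulrN t3d oppr0.
  by rewrite !simpl.
have t4d l : t4 * d (v3, v2) 0 l = 0.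
  have := E v1 v1 v2 l; rewrite !sum_ord3 ![d (v1, v1) 0 v1]od ?[d (v1, v1) 0 v2]od //.
  by rewrite ![d (v1, v2) 0 v1]od ?[d (v1, v2) 0 v2]od // d12 !simpl.
(* The v_3 component at (v_2, v_2, v_3) gives d(v_3, v_3) = (t_1 t_3 + t_2) v_3, where t_1 t_3 =
   0. *)
have d33 : d (v3, v3) 0 v3 = t2.
  have := E v2 v2 v3 v3; rewrite !sum_ord3 ![d (v2, v2) 0 v1]od ?[d (v2, v2) 0 v2]od //.
  rewrite d22 !d23 [d (v3, v2) 0 v3]od // !mulNr.
  rewrite [_ * d (v2, v1) 0 v3]mulrC -/t3 t3d oppr0 expr0 !simpl.
  by move/eqP; rewrite subr0 subr_eq0 => /eqP.
split; [|by rewrite mulrC; apply: t3d|by rewrite mulrC; apply: t4d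
        |by rewrite mulrC; apply: t3d|by rewrite mulrC; apply: t4d].
apply/ffunP => -[i j]; apply/rowP => k; rewrite normal_formE.
elim/ord3_ind: i; elim/ord3_ind: j; elim/ord3_ind: k => //=;
  rewrite ?d13 ?d31 ?d23 //; by rewrite od ?oppr0.
Qed.

End EvenMatrices.

(** * Equivalences over a field *)

Section EquivalencesOverFields.
Variable K : fieldType.
Implicit Types (a b c d p q : K).

(** The change of basis is v_1 to a v_1, v_2 to c v_1 + d v_2 and v_3 to d^2 v_3, the last factor
    being forced by d(v_2, v_2) = v_3. The two equations compare the values at (v_3, v_2). *)
Lemma normal_form_equiv a c d t1 t2 s1 s2 : a != 0 -> d != 0 ->
  s2 = d ^+ 2 * t2 -> s1 * a + s2 * c = d ^+ 3 * t1 ->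
  codiff_equiv (normal_form t1 t2 0 0) (normal_form s1 s2 0 0).
Proof.
move=> a0 d0 s2E s1E.
have {}s1E : s1 = (d ^+ 3 * t1 - s2 * c) / a by apply: (canRL (mulfK a0)); rewrite -s1E addrK.
exists (even_block a 0 c d (d ^+ 2)), (even_block a^-1 0 (- c / (a * d)) d^-1 (d ^- 2)).
split; first exact: even_even_block.
apply: transports_from_components.
- rewrite mul_even_block -even_block1; congr even_block; field; rewrite ?a0 ?d0 //.
- rewrite mul_even_block -even_block1; congr even_block; field; rewrite ?a0 ?d0 //.
move=> i j k; rewrite !sum_ord3 !normal_formE !mxE s1E s2E.
elim/ord3_ind: i; elim/ord3_ind: j; elim/ord3_ind: k => /=;
  rewrite ?(mulr0, mul0r, mulr1, mul1r, addr0, add0r) //; field => //.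
Qed.

(* Replacing v_1 by v_1 - q v_2 turns the form of d13 p q into the shape
   ((- p q, 0), (p - q, 1)); the factor t rescales v_1. *)
Lemma d13_equiv p q t : t != 0 ->
  codiff_equiv (normal_form 0 0 ((p - q) * t) (- (p * q) * t ^+ 2)) (d13 p q).
Proof.
move=> t0; exists (even_block t^-1 q 0 1 1), (even_block t (- q * t) 0 1 1).
split; first exact: even_even_block.
apply: transports_from_components.
- rewrite mul_even_block -even_block1; congr even_block; field => //.
- rewrite mul_even_block -even_block1; congr even_block; field => //.
move=> i j k; rewrite !sum_ord3 !normal_formE !mxE /d13 !ffunE !mxE.
elim/ord3_ind: i; elim/ord3_ind: j; elim/ord3_ind: k => /=;
  rewrite ?(mulr0, mul0r, mulr1, mul1r, addr0, add0r) //; field => //.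
Qed.

(** Comparing values at (v_3, v_3) gives s_2 u = u^2 t_2, where [u] is the entry of [g] at v_3 and
    is nonzero because [g] is invertible and even. *)
Lemma normal_form_equiv_unit (t1 t2 s1 s2 : K) :
  codiff_equiv (normal_form t1 t2 0 0) (normal_form s1 s2 0 0) -> s2 != 0 -> t2 != 0.
Proof.
move=> [g [g' [eg gg']]] s0.
have g3 j : parity j != true -> g v3 j = 0 by move=> pj; apply: (even_mxE eg); rewrite eq_sym.
have := @transports_components _ _ _ _ _ v3 v3 v3 gg'.
rewrite !sum_ord3 !normal_formE /= (g3 v1) // (g3 v2) // !(mulr0, mul0r, addr0, add0r) => E.
apply/eqP => t0; move: E; rewrite t0 mulr0 => /eqP; rewrite mulf_eq0 (negPf s0) /= => /eqP u0.
case: gg' => /matrixP/(_ v3 v3); rewrite !mxE sum_ord3 (g3 v1) // (g3 v2) // u0 !mul0r !addr0 /=.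
by move=> /eqP; rewrite eq_sym oner_eq0.
Qed.

Lemma normal_form_equiv0 (t3 t4 : K) :
  codiff_equiv (normal_form 0 0 t3 t4) (normal_form 0 0 0 0) -> t3 = 0 /\ t4 = 0.
Proof.
(* With the equivalence inverted, products of entries of [g] are contracted with psi^{22}_3, and
   only the product of the two v_2 entries survives. *)
move=> [g' [g [eg' gg']]]; have {}gg' := transports_sym gg'.
have E i j k := @transports_components _ _ _ _ _ i j k gg'.
have simpl := (mulr0, mul0r, mulr1, mul1r, addr0, add0r).
(* If this entry vanished, the value at (v_2, v_2) would make the third row of [g] zero. *)
have g22 : g v2 v2 != 0.
  apply/eqP => g0; have g3 k : g v3 k = 0.
    have := E v2 v2 k; rewrite !sum_ord3 !normal_formE /= g0 !simpl => ->.
    by elim/ord3_ind: k; rewrite /= !simpl.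
  case: gg' => /matrixP/(_ v3 v3); rewrite !mxE sum_ord3 !g3 !simpl /= => /eqP.
  by rewrite eq_sym oner_eq0.
have := E v2 v2 v3; rewrite !sum_ord3 !normal_formE /= !simpl => g33.
have g330 : g v3 v3 != 0 by rewrite g33 mulf_neq0.
have := E v1 v2 v3; rewrite !sum_ord3 !normal_formE /= !simpl => /esym/eqP.
rewrite mulf_eq0 (negPf g22) orbF => /eqP g12.
split.
  have := E v2 v1 v3; rewrite !sum_ord3 !normal_formE /= g12 !simpl => /eqP.
  by rewrite mulf_eq0 (negPf g330) orbF => /eqP.
have := E v1 v1 v3; rewrite !sum_ord3 !normal_formE /= g12 !simpl => /eqP.
by rewrite mulf_eq0 (negPf g330) orbF => /eqP.
Qed.

End EquivalencesOverFields.

(** * Versality *)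

Lemma d13_00 (A : comNzRingType) : d13 (0 : A) 0 = normal_form 0 0 0 0.
Proof.
apply/ffunP => -[i j]; apply/rowP => k; rewrite normal_formE /d13 !scale0r !addr0 !ffunE !mxE.
by elim/ord3_ind: i; elim/ord3_ind: j; elim/ord3_ind: k => /=; rewrite ?oppr0.
Qed.

Lemma rmorph_normal_coef (A B : comNzRingType) (f : {rmorphism A -> B}) t1 t2 t3 t4 i j k :
  f (normal_coef t1 t2 t3 t4 i j k) = normal_coef (f t1) (f t2) (f t3) (f t4) i j k.
Proof.
case: i => [|[|[|i]]]; case: j => [|[|[|j]]]; case: k => [|[|[|k]]];
  by rewrite ?rmorph0 ?rmorph1 ?rmorphN.
Qed.

Lemma in_alg_d13_00 (K : comNzRingType) (B : comAlgType K) :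
  [ffun ij => map_mx (in_alg B) (d13 (0 : K) 0 ij)] = normal_form 0 0 0 0.
Proof.
apply/ffunP => -[i j]; apply/rowP => k.
by rewrite d13_00 normal_formE ffunE mxE normal_formE rmorph_normal_coef rmorph0.
Qed.

Section Versality.
Variables (K : fieldType) (B : augAlg K).
Local Notation m := (@aug_ideal K B).
Implicit Types (dB : cochain B).
Let idm := @aug_ideal_is_ideal K B.

Lemma deformation_d13E dB i j k : deformation (d13 (0 : K) 0) dB ->
  m (dB (i, j) 0 k - normal_form 0 0 0 0 (i, j) 0 k).
Proof.
move=> [phi [phim _ -> _]]; rewrite in_alg_d13_00 ffunE mxE addrAC subrr add0r.
exact: phim.
Qed.

Lemma normal_form_deformation t1 t2 t3 t4 : m t1 -> m t2 -> m t3 -> m t4 ->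
  t1 * t3 = 0 -> t1 * t4 = 0 -> t2 * t3 = 0 -> t2 * t4 = 0 ->
  deformation (d13 (0 : K) 0) (normal_form t1 t2 t3 t4).
Proof.
move=> m1 m2 m3 m4 h13 h14 h23 h24.
exists (normal_form t1 t2 t3 t4 - [ffun ij => map_mx (in_alg B) (d13 (0 : K) 0 ij)]).
have E i j k : (normal_form t1 t2 t3 t4 -
    [ffun ij => map_mx (in_alg B) (d13 (0 : K) 0 ij)]) (i, j) 0 k =
    normal_coef t1 t2 t3 t4 i j k - normal_coef 0 0 0 0 i j k.
  by rewrite in_alg_d13_00 !ffunE !mxE.
split.
- have m0 : m 0 by case: idm.
  have mN x : m x -> m (- x) by exact: is_idealN.
  move=> [i j] k; rewrite E.
  by elim/ord3_ind: i; elim/ord3_ind: j; elim/ord3_ind: k => /=;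
    rewrite ?oppr0 ?addr0 ?subrr //; apply: mN.
- apply/odd_cochainP => i j k; rewrite E.
  by elim/ord3_ind: i; elim/ord3_ind: j; elim/ord3_ind: k => //= _; rewrite subrr.
- by rewrite addrC subrK.
- exact: codifferential_normal_form.
Qed.

(** Modulo the maximal ideal the change of basis is the identity, so the structure constants keep
    their augmentations. *)
Lemma aug_transports (L g' : 'M[B]_3) (d d' : cochain B) i j k :
  (forall i j, m (L i j)) -> transports (1%:M + L) g' d d' ->
  aug B (d' (i, j) 0 k) = aug B (d (i, j) 0 k).
Proof.
move=> mL T; have augL a b : aug B ((1%:M + L) a b) = (a == b)%:R.
  rewrite !mxE raddfD /= [X in _ + X]mL addr0; case: eqP => _; last exact: raddf0.
  exact: rmorph1.
have := congr1 (aug B) (transports_components i j k T).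
rewrite !raddf_sum /= (bigD1 k) //= rmorphM /= augL eqxx mulr1 big1 ?addr0; last first.
  by move=> l lk; rewrite rmorphM /= augL (negPf lk) mulr0.
move=> ->; rewrite (bigD1 i) //= raddf_sum (bigD1 j) //= !rmorphM /= !augL !eqxx !mul1r.
rewrite big1 ?addr0; last first.
  by move=> b bj; rewrite !rmorphM /= !augL [j == b]eq_sym (negPf bj) mulr0 mul0r.
rewrite big1 ?addr0 // => a ai; rewrite raddf_sum big1 // => b _ /=.
by rewrite !rmorphM /= !augL [i == a]eq_sym (negPf ai) !mul0r.
Qed.

Lemma deformation_normal_form dB : adically_complete m -> deformation (d13 (0 : K) 0) dB ->
  exists t1 t2 t3 t4, [/\ m t1, m t2, m t3 & m t4] /\
   [/\ t1 * t3 = 0, t1 * t4 = 0, t2 * t3 = 0 & t2 * t4 = 0] /\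
   def_equiv (normal_form t1 t2 t3 t4) dB.
Proof.
move=> cB defB; have [phi [_ _ _ cd]] := defB.
have augB i j k : aug B (dB (i, j) 0 k) = aug B (normal_form 0 0 0 0 (i, j) 0 k).
  by apply/eqP; rewrite -subr_eq0 -raddfB; apply/eqP; apply: deformation_d13E.
set a := dB (v2, v2) 0 v3; set c := dB (v1, v2) 0 v3.
have ma : aug B a = 1 by rewrite augB normal_formE rmorph1.
have mc : aug B c = 0 by rewrite augB normal_formE raddf0.
have [u au] : exists u, a * u = 1 by apply: (aug_unit cB); rewrite ma oner_eq0.
have mu : aug B u = 1.
  by rewrite -[LHS]mul1r -ma -rmorphM au rmorph1.
(* Here [u] is the inverse of [a]. The matrix [g'] sends v_1 to v_1 - (c/a) v_2, which kills the
   value at (v_1, v_2), and v_3 to a v_3, which makes the value at (v_2, v_2) equal to v_3. *)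
pose b := c * u; have mb : m b by rewrite /aug_ideal /= rmorphM /= mc mul0r.
pose g := even_block 1 b 0 1 u; pose g' := even_block 1 (- b) 0 1 a.
have gg' : g *m g' = 1%:M.
  by rewrite mul_even_block -even_block1; congr even_block; rewrite ?[u * a]mulrC ?au //; ring.
have g'g : g' *m g = 1%:M.
  by rewrite mul_even_block -even_block1; congr even_block; rewrite ?au //; ring.
pose d' : cochain B := [ffun ij => ext dB (row ij.1 g') (row ij.2 g') *m g].
have T : transports g' g dB d'.
  by apply: transports_basis => // i j; rewrite ffunE -mulmxA gg' mulmx1.
have cd' : codifferential d' by apply: codifferential_transports T _ _ cd; apply: even_even_block.
have blockE x y z w v :
    even_block (1 + x) y z (1 + w) (1 + v) = 1%:M + even_block x y z w v :> 'M[B]_3.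
  apply/matrixP => i j; rewrite -even_block1 !mxE.
  by elim/ord3_ind: i; elim/ord3_ind: j => /=; rewrite ?addr0 ?add0r.
have m0 : m 0 by case: idm.
have m_block x y z w v : m x -> m y -> m z -> m w -> m v ->
    forall i j, m (even_block x y z w v i j).
  by move=> mx my mz mw mv i j; rewrite mxE; elim/ord3_ind: i; elim/ord3_ind: j.
have augd' i j k : aug B (d' (i, j) 0 k) = aug B (normal_form 0 0 0 0 (i, j) 0 k).
  rewrite -augB; apply: (@aug_transports (even_block 0 (- b) 0 0 (a - 1)) g).
    by apply: m_block => //; rewrite ?/aug_ideal /=
      ?raddfN ?raddfB /= ?mb ?oppr0 // ma rmorph1 subrr.
  by rewrite -blockE addr0 addrCA subrr addr0.
have d'12 : d' (v1, v2) 0 v3 = 0.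
  rewrite ffunE mxE sum_ord3 !ext_rowE !sum_ord3 !mxE /= -/a -/c.
  rewrite !(mulr0, mul0r, addr0, add0r) !mul1r !mulr1 /b.
  by transitivity ((c - c * (a * u)) * u); [ring|rewrite au mulr1 subrr mul0r].
have d'22 : d' (v2, v2) 0 v3 = 1.
  rewrite ffunE mxE sum_ord3 !ext_rowE !sum_ord3 !mxE /= -/a -/c.
  by rewrite !(mulr0, mul0r, addr0, add0r) !mul1r au.
have [d'E h13 h14 h23 h24] := normal_form_exhaustive cd' d'12 d'22.
exists (d' (v3, v2) 0 v1), (d' (v3, v2) 0 v2), (d' (v2, v1) 0 v3), (d' (v1, v1) 0 v3).
split; first by split; rewrite /aug_ideal /= augd' normal_formE raddf0.
(* Leaving the normal form uses the inverse transport, whose matrix [g] is again the identity modulo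
   m. *)
split=> //; rewrite -d'E; exists (even_block 0 b 0 0 (u - 1)), g'; split.
- by apply: m_block => //; rewrite /aug_ideal /= raddfB /= mu rmorph1 subrr.
- exact: even_even_block.
- rewrite -blockE addr0 addrCA subrr addr0; exact: transports_sym.
Qed.

(** To first order the change of basis leaves t_1, t_2 and t_4 alone. It adds the entry of [L] from
    v_1 to v_2 to the values at (v_1, v_2) and (v_2, v_1) alike, so their difference is t_3. *)
Lemma def_equiv_normal_form t1 t2 t3 t4 dB : infinitesimal B ->
    m t1 -> m t2 -> m t3 -> m t4 -> deformation (d13 (0 : K) 0) dB ->
    def_equiv (normal_form t1 t2 t3 t4) dB ->
  [/\ t1 = dB (v3, v2) 0 v1, t2 = dB (v3, v2) 0 v2,
      t3 = dB (v2, v1) 0 v3 - dB (v1, v2) 0 v3 & t4 = dB (v1, v1) 0 v3].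
Proof.
move=> iB m1 m2 m3 m4 defB [L [g' [mL eL T]]].
have mdB (i j k : 'I_3) : normal_coef (0 : B) 0 0 0 i j k = 0 -> m (dB (i, j) 0 k).
  by move=> nf0; have := @deformation_d13E dB i j k defB; rewrite normal_formE nf0 subr0.
have E i j k := transports_components i j k T.
have Lod i j : parity i != parity j -> L i j = 0 by exact: even_mxE.
have Lz := (Lod v1 v3 isT, Lod v2 v3 isT, Lod v3 v1 isT, Lod v3 v2 isT).
have simpl := (mulr0, mul0r, mulr1, mul1r, addr0, add0r).
(* As m squares to zero, elements of m absorb factors 1 + L i j and annihilate factors L i j. *)
have absr x i j : m x -> x * (1 + L i j) = x by move=> mx; rewrite mulrDr mulr1 iB ?addr0.
have absl x i j : m x -> (1 + L i j) * x = x by move=> mx; rewrite mulrC absr.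
have Z x i j : m x -> x * L i j = 0 by move=> mx; rewrite iB.
have Z' x i j : m x -> L i j * x = 0 by move=> mx; rewrite iB.
have e1 := E v3 v2 v1; have e2 := E v3 v2 v2; have e3 := E v2 v1 v3.
have e3' := E v1 v2 v3; have e4 := E v1 v1 v3.
do [rewrite !sum_ord3 !normal_formE !mxE !Lz /= !simpl] in e1 e2 e3 e3' e4.
have d321 : m (dB (v3, v2) 0 v1) by exact: mdB.
have d322 : m (dB (v3, v2) 0 v2) by exact: mdB.
have d213 : m (dB (v2, v1) 0 v3) by exact: mdB.
have d123 : m (dB (v1, v2) 0 v3) by exact: mdB.
have d113 : m (dB (v1, v1) 0 v3) by exact: mdB.
rewrite (absr _ _ _ d321) (Z _ _ _ d322) addr0 -mulrA !(absl t1) // in e1.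
rewrite (absr _ _ _ d322) (Z _ _ _ d321) add0r -mulrA !(absl t2) // in e2.
rewrite (absr _ _ _ d213) -!mulrA !(absl t4) // !(absl t3) // (Z' t4) // add0r
  (absl (L v1 v2)) // in e3.
rewrite (absr _ _ _ d123) -!mulrA !(Z' t4) // !(Z' t3) // !mulr0 !add0r (absr (L v1 v2)) // in e3'.
rewrite (absr _ _ _ d113) -!mulrA !(absl t4) // !(absl t3) // (Z' t3) //
  (Z' (L v1 v2)) // !addr0 in e4.
by split=> //; rewrite e3 e3' addrK.
Qed.

End Versality.

Lemma ord4_ind (P : 'I_4 -> Prop) : P 0 -> P 1 -> P 2%:R -> P 3%:R -> forall i, P i.
Proof.
move=> P0 P1 P2 P3 [[|[|[|[|//]]]] i4].
- by rewrite (_ : Ordinal i4 = 0) //; apply/val_inj.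
- by rewrite (_ : Ordinal i4 = 1) //; apply/val_inj.
- by rewrite (_ : Ordinal i4 = 2%:R) //; apply/val_inj.
- by rewrite (_ : Ordinal i4 = 3%:R) //; apply/val_inj.
Qed.

(** * Miniversality of [dinf_base] *)

Section Miniversality.
Variable K : fieldType.
Local Notation t i := (base_pi (fps_var K (i : 'I_4))).

Lemma base_relations :
  [/\ t 0 * t 2%:R = 0, t 0 * t 3%:R = 0, t 1 * t 2%:R = 0 & t 1 * t 3%:R = 0].
Proof.
have E i j : (U_(i) + U_(j))%MM \in mixed_gens -> t i * t j = 0.
  move=> ij; rewrite base_piM -[0](raddf0 (@base_pi K)); apply/base_pi_eq.
  by rewrite subr0; apply: mixed_var.
by split; apply: E; rewrite !inE eqxx ?orbT.
Qed.

Lemma dinf_baseE : dinf_base K = normal_form (t 0) (t 1) (t 2%:R) (t 3%:R).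
Proof. by have [h1 h2 h3 _] := base_relations; apply: dinf_normal_form. Qed.

Lemma pushforward_dinf_base (B : augAlg K) (f : {lrmorphism base K -> B}) :
  pushforward f (dinf_base K) = normal_form (f (t 0)) (f (t 1)) (f (t 2%:R)) (f (t 3%:R)).
Proof.
have [h1 h2 h3 _] := base_relations.
by rewrite -dinf_normal_form; [exact: pushforward_dinf|rewrite -rmorphM ?h1 ?h2 ?h3 raddf0..].
Qed.

Lemma dinf_base_miniversal : miniversal (d13 (0 : K) 0) (dinf_base K).
Proof.
split; first split.
- exact/complete_formal_base/base_complete.
- rewrite dinf_baseE; have [h1 h2 h3 h4] := base_relations.
  by apply: normal_form_deformation => //; apply: aug_base_var.
- move=> B dB [_ _ cB] defB.
  have [t1 [t2 [t3 [t4 [[m1 m2 m3 m4] [rel eqv]]]]]] := deformation_normal_form cB defB.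
  pose b (i : 'I_4) : B := [:: t1; t2; t3; t4]`_i.
  have [||f [af fE]] := @base_lift K B b cB.
  + by elim/ord4_ind.
  + by apply/relationsP.
  by exists f; split=> //; rewrite pushforward_dinf_base !fE.
(* For uniqueness, both morphisms must send each variable to the same expression in the entries of
   [dB]. *)
move=> B dB _ iB defB f f' af ef af' ef'; apply: (base_morphism_ext iB af af').
have mf (g : {lrmorphism base K -> B}) : aug_morphism g -> forall i, aug_ideal (g (t i)).
  by move=> ag i; rewrite /aug_ideal /= ag; exact: aug_base_var.
rewrite pushforward_dinf_base in ef; rewrite pushforward_dinf_base in ef'.
have {}af := mf f af; have {}af' := mf f' af'.
have [e1 e2 e3 e4] := def_equiv_normal_form iB (af _) (af _) (af _) (af _) defB ef.
have [e1' e2' e3' e4'] := def_equiv_normal_form iB (af' _) (af' _) (af' _) (af' _) defB ef'.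
by elim/ord4_ind; [rewrite e1 e1'|rewrite e2 e2'|rewrite e3 e3'|rewrite e4 e4'].
Qed.

End Miniversality.

(** * The zero locus of the relations *)

Section Loci.
Variable K : fieldType.
Implicit Types (x : 'rV[K]_4).

Lemma solutionP (t1 t2 t3 t4 : K) :
  solution t1 t2 t3 t4 <-> (t3 = 0 /\ t4 = 0) \/ (t1 = 0 /\ t2 = 0).
Proof.
rewrite /solution relationsP; split=> [[h13 h14 h23 h24]|]; last first.
  by move=> [[-> ->]|[-> ->]]; rewrite ?mulr0 ?mul0r.
have [t30|t30] := eqVneq t3 0; last first.
  by right; split; apply/eqP; rewrite -(mulIr_eq0 _ (mulIf t30)) ?h13 ?h23.
have [t40|t40] := eqVneq t4 0; first by left.
by right; split; apply/eqP; rewrite -(mulIr_eq0 _ (mulIf t40)) ?h14 ?h24.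
Qed.

Lemma vec4E x : x = vec4 (x 0 0) (x 0 1) (x 0 2%:R) (x 0 3%:R).
Proof. by apply/rowP => i; rewrite !mxE; elim/ord4_ind: i. Qed.

Lemma vec4_span t1 t2 t3 t4 : vec4 t1 t2 t3 t4 =
  t1 *: delta_mx 0 0 + t2 *: delta_mx 0 1 +
  (t3 *: delta_mx 0 2%:R + t4 *: delta_mx 0 3%:R) :> 'rV[K]_4.
Proof.
by apply/rowP; elim/ord4_ind; rewrite !mxE /= ?(mulr0, mulr1, addr0, add0r).
Qed.

Definition plane (i j : 'I_4) : {vspace 'rV[K]_4} := (<[delta_mx 0%R i]> + <[delta_mx 0%R j]>)%VS.

Lemma planeP i j x :
  reflect (exists a b, x = a *: delta_mx 0 i + b *: delta_mx 0 j) (x \in plane i j).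
Proof.
apply: (iffP memv_addP) => [[_ /vlineP[a ->] [_ /vlineP[b ->] ->]]|[a [b ->]]].
  by exists a, b.
exists (a *: delta_mx 0 i); first by apply/vlineP; exists a.
by exists (b *: delta_mx 0 j) => //; apply/vlineP; exists b.
Qed.

Lemma plane01P t1 t2 t3 t4 : vec4 t1 t2 t3 t4 \in plane 0 1 <-> t3 = 0 /\ t4 = 0.
Proof.
split=> [/planeP[a [b E]]|[-> ->]].
  by have [/rowP/(_ 2%:R) + /rowP/(_ 3%:R)] := (E, E); rewrite !mxE /= !mulr0 !addr0.
by apply/planeP; exists t1, t2; rewrite vec4_span !scale0r !addr0.
Qed.

Lemma plane23P t1 t2 t3 t4 : vec4 t1 t2 t3 t4 \in plane 2%:R 3%:R <-> t1 = 0 /\ t2 = 0.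
Proof.
split=> [/planeP[a [b E]]|[-> ->]].
  by have [/rowP/(_ 0) + /rowP/(_ 1)] := (E, E); rewrite !mxE /= !mulr0 !addr0.
by apply/planeP; exists t3, t4; rewrite vec4_span !scale0r !add0r.
Qed.

Lemma planes_transversal :
  (plane 0%R 1%R + plane 2%:R 3%:R)%VS = fullv /\ (plane 0%R 1%R :&: plane 2%:R 3%:R)%VS = 0%VS.
Proof.
split.
  apply/eqP; rewrite eqEsubv subvf; apply/subvP => x _; rewrite (vec4E x) vec4_span.
  by apply: memv_add; apply/planeP; do 2 eexists.
apply/eqP; rewrite -subv0; apply/subvP => x; rewrite memv_cap memv0 (vec4E x).
move=> /andP[/plane01P[-> ->] /plane23P[-> ->]].
by rewrite vec4_span !scale0r !addr0.
Qed.

(** Each plane is spanned by two vectors, and by transversality the two dimensions add up to 4. *)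
Lemma dim_planes : \dim (plane 0 1) = 2%N /\ \dim (plane 2%:R 3%:R) = 2%N.
Proof.
have le2 i j : (\dim (plane i j) <= 2)%N.
  by apply: leq_trans (dimv_add_leqif _ _) _; rewrite !dim_vline; do 2 case: (_ != 0).
have [full cap0] := planes_transversal; have := dimv_disjoint_sum cap0.
rewrite full dimvf dim_matrix; have := le2 0 1; have := le2 2%:R 3%:R.
by move: (\dim _) (\dim _) => [|[|[|a]]] [|[|[|b]]].
Qed.

End Loci.

(** * Jump deformations along polynomial curves in the base *)

Section Jumps.
Variable K : numFieldType.

Lemma near0_all (P : K -> Prop) : (forall t, P t) -> \forall t \near (0 : K^o), P t.
Proof. by move=> Pt; exact: (@filterE _ _ (nbhs_filter (0 : K^o)) _ Pt). Qed.

Lemma analytic_horner (p : {poly K}) (f : K -> K) : (forall t, f t = p.[t]) -> analytic_at0 f.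
Proof.
(* The partial sums are constant from index [size p] on. *)
move=> fp; exists (fun k => p`_k); apply: near0_all => t; apply: cvg_near_cst.
by exists (size p) => // n /= pn; rewrite fp (horner_coef_wide _ pn).
Qed.

Lemma jump_dinf (p1 p2 p3 p4 : {poly K}) (f1 f2 f3 f4 : K -> K) d' :
  (forall t, f1 t = p1.[t]) -> (forall t, f2 t = p2.[t]) ->
  (forall t, f3 t = p3.[t]) -> (forall t, f4 t = p4.[t]) ->
  (forall t, [/\ f1 t * f3 t = 0, f1 t * f4 t = 0, f2 t * f3 t = 0 & f2 t * f4 t = 0]) ->
  [/\ f1 0 = 0, f2 0 = 0, f3 0 = 0 & f4 0 = 0] ->
  (forall t, t != 0 -> codiff_equiv (dinf (f1 t) (f2 t) (f3 t) (f4 t)) d') ->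
  jump_deformation (d13 0 0) d' (fun t => dinf (f1 t) (f2 t) (f3 t) (f4 t)).
Proof.
move=> f1E f2E f3E f4E rel [f10 f20 f30 f40] eqv; split.
- move=> ij k; apply: (@analytic_horner (dinf p1 p2 p3 p4 ij 0 k)) => t.
  (* Each entry is polynomial in [t]: it is the entry of [dinf] over the polynomial ring, evaluated
     at [t]. *)
  rewrite f1E f2E f3E f4E -!/(horner_eval t _) -pushforward_dinf.
  by rewrite ffunE mxE.
- by rewrite f10 f20 f30 f40 d13_00 dinf_normal_form ?mulr0.
- apply: near0_all => t; have [h13 h14 h23 h24] := rel t.
  by rewrite dinf_normal_form //; apply: codifferential_normal_form.
- by apply: near0_all.
Qed.

Lemma near0_neq0 (P : K -> Prop) : (\forall t \near (0 : K^o), P t) -> exists2 t, t != 0 & P t.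
Proof.
move=> /nbhs_ballP[e /= e0 eP]; exists (e / 2%:R).
  by rewrite mulf_neq0 ?invr_eq0 ?pnatr_eq0 // lt0r_neq0.
apply: eP; rewrite /ball /= sub0r normrN gtr0_norm ?divr_gt0 ?ltr0n //.
by rewrite ltr_pdivrMr ?ltr0n // ltr_pMr // ltr1n.
Qed.

End Jumps.

(** * The miniversal deformation, its two planes and their jumps *)

Unset Implicit Arguments.

Theorem mainTheorem6 (R : realType) :
  miniversal (d13 (0 : R[i]) 0) (dinf_base R[i]) /\
  (forall t1 t2 t3 t4 : R[i],
     solution t1 t2 t3 t4 <-> (t3 = 0 /\ t4 = 0) \/ (t1 = 0 /\ t2 = 0)) /\
  (exists P1 P2 : {vspace 'rV[R[i]]_4},
     (forall t1 t2 t3 t4, vec4 t1 t2 t3 t4 \in P1 <-> t3 = 0 /\ t4 = 0) /\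
     (forall t1 t2 t3 t4, vec4 t1 t2 t3 t4 \in P2 <-> t1 = 0 /\ t2 = 0) /\
     \dim P1 = 2%N /\ \dim P2 = 2%N /\
     (P1 + P2)%VS = fullv /\ (P1 :&: P2)%VS = 0%VS) /\
  (forall t1 t2 : R[i],
     dinf t1 t2 0 0 = psi 2 2 3 + t1 *: psi 3 2 1 - t1 *: psi 2 3 1
       + t2 *: psi 3 2 2 - t2 *: psi 2 3 2 + t2 *: psi 3 3 3 /\
     codifferential (dinf t1 t2 0 0) /\
     (codiff_equiv (dinf t1 t2 0 0) d1 <-> t2 <> 0)) /\
  (forall t1 : R[i], t1 <> 0 -> codiff_equiv (dinf t1 0 0 0) d12) /\
  jump_deformation (d13 (0 : R[i]) 0) d12 (fun t => dinf t 0 0 0) /\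
  (forall t3 t4 : R[i],
     dinf 0 0 t3 t4 = psi 2 2 3 + t3 *: psi 2 1 3 + t4 *: psi 1 1 3 /\
     codifferential (dinf 0 0 t3 t4)) /\
  (forall p q : R[i], (p, q) <> (0, 0) <->
     exists t3 t4 : R[i] -> R[i],
       (\forall t \near (0 : R[i]^o), t != 0 -> (t3 t, t4 t) <> (0, 0)) /\
       jump_deformation (d13 0 0) (d13 p q) (fun t => dinf 0 0 (t3 t) (t4 t))).
Proof.
have d1E (A : comNzRingType) : d1 = normal_form 0 (-1) 0 0 :> cochain A.
  apply/ffunP => -[i j]; apply/rowP => k; rewrite normal_formE !ffunE !mxE.
  by elim/ord3_ind: i; elim/ord3_ind: j; elim/ord3_ind: k;
    rewrite /= ?oppr0 ?opprK ?addr0 ?add0r.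
have d12E (A : comNzRingType) : d12 = normal_form (-1) 0 0 0 :> cochain A.
  apply/ffunP => -[i j]; apply/rowP => k; rewrite normal_formE !ffunE !mxE.
  by elim/ord3_ind: i; elim/ord3_ind: j; elim/ord3_ind: k;
    rewrite /= ?oppr0 ?opprK ?addr0 ?add0r.
have d12_equiv (t1 : R[i]) : t1 <> 0 -> codiff_equiv (dinf t1 0 0 0) d12.
  move=> /eqP t10; rewrite dinf_normal_form ?mulr0 // d12E.
  (* Since [d12] has first parameter -1, scaling v_1 by [- t1] suffices. *)
  apply: (@normal_form_equiv _ (- t1) 0 1); rewrite ?oppr_eq0 ?oner_eq0 ?mulr0 //.
  by rewrite addr0 expr1n mulN1r opprK mul1r.
split; first exact: dinf_base_miniversal.
split; first exact: solutionP.
split.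
  exists (plane _ 0 1), (plane _ 2%:R 3%:R).
  have [full cap0] := planes_transversal R[i]; have [dim1 dim2] := dim_planes R[i].
  by split; [exact: plane01P|split; [exact: plane23P|]].
split.
  move=> t1 t2; split; first last.
    rewrite dinf_normal_form ?mulr0 //; split.
      by apply: codifferential_normal_form; rewrite mulr0.
    rewrite d1E; split=> [/normal_form_equiv_unit t20|/eqP t20].
      by apply/eqP/t20; rewrite oppr_eq0 oner_eq0.
    (* A square root of -1/t_2 makes s_2 = d^2 t_2 equal to -1, the parameter of [d1]; then c = -
       d^3 t_1 makes s_1 zero. *)
    have [d dE] : exists d : R[i], d ^+ 2 = - t2^-1 by exists (sqrtC (- t2^-1)); rewrite sqrtCK.
    apply: (@normal_form_equiv _ 1 (- (d ^+ 3 * t1)) d); rewrite ?oner_eq0 //.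
    - by rewrite -sqrf_eq0 dE oppr_eq0 invr_eq0.
    - by rewrite dE mulNr mulVf.
    - by rewrite mul0r add0r mulN1r opprK.
  (* The elementary cochains are generalized so that [ring] treats their entries as atoms. *)
  rewrite /dinf; move: (psi 2 2 3) (psi 1 1 3) (psi 2 1 3) (psi 3 3 3) (psi 2 3 1) (psi 3 1 1)
    (psi 3 2 1) (psi 1 3 2) (psi 2 3 2) (psi 3 1 2) (psi 3 2 2) => *.
  by apply/ffunP => -[i j]; apply/rowP => k; rewrite !ffunE !mxE; ring.
split; first exact: d12_equiv.
split.
  apply: (@jump_dinf R[i] 'X 0 0 0) => [t|t|t|t|t||t /eqP]; rewrite ?hornerX ?horner0 //.
    by rewrite !mulr0.
  exact: d12_equiv.
split.
  move=> t3 t4; split; last first.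
    rewrite dinf_normal_form ?mul0r //; apply: codifferential_normal_form; exact: mul0r.
  rewrite /dinf; move: (psi 2 2 3) (psi 1 1 3) (psi 2 1 3) (psi 3 3 3) (psi 2 3 1) (psi 3 1 1)
    (psi 3 2 1) (psi 1 3 2) (psi 2 3 2) (psi 3 1 2) (psi 3 2 2) => *.
  by apply/ffunP => -[i j]; apply/rowP => k; rewrite !ffunE !mxE; ring.
(* For p = q = 0, a fibre at some t != 0 would be equivalent to psi^{22}_3, forcing t_3 = t_4 = 0
   there against the nonvanishing condition. *)
move=> p q; split=> [pq|[t3 [t4 [t34 [_ _ _ eqv]]]] [p0 q0]]; last first.
  have [t t0 [/(_ t0) nt0 /(_ t0)]] := near0_neq0 (filterI t34 eqv).
  rewrite p0 q0 d13_00 dinf_normal_form ?mul0r // => /normal_form_equiv0[t30 t40].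
  by apply: nt0; rewrite t30 t40.
(* This is the curve of [d13_equiv]. It avoids the origin for t != 0, because p = q and p q = 0
   would give p = q = 0. *)
exists (fun t => (p - q) * t), (fun t => - (p * q) * t ^+ 2); split.
  apply: near0_all => t /eqP t0 [] /eqP; rewrite mulf_eq0 subr_eq0 => /orP[/eqP pqE|/eqP //].
  move=> /eqP; rewrite mulf_eq0 expf_eq0 /= (negPf (introN eqP t0)) orbF oppr_eq0 pqE mulf_eq0 orbb.
  by move=> /eqP q0; apply: pq; rewrite pqE q0.
apply: (@jump_dinf R[i] 0 0 ((p - q)%:P * 'X) (- (p * q)%:P * 'X ^+ 2)) => [t|t|t|t|t||t t0].
- by rewrite horner0.
- by rewrite horner0.
- by rewrite !hornerE.
- by rewrite !hornerE.
- by rewrite !mul0r.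
- by rewrite expr0n !mulr0.
- by rewrite dinf_normal_form ?mul0r //; apply: d13_equiv.
Qed.
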